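(* Let $x \in \mathcal{A}^{\mathbb{Z}}$ be a bi-infinite word over a finite alphabet $\mathcal{A}$. Then $x$ has a finite string attractor if and only if it falls in one of the following (mutually disjoint) cases: (1) $x$ is purely periodic of minimal period $p$, in which case $p_x(n) = p > \mathrm{span}(x)$ for all large enough $n$; (2) $x$ is eventually periodic but not purely periodic, in which case $p_x(n) = n + \mathrm{span}(x)$ for all large enough $n$; (3) $x$ is, up to finite shift, characteristic quasi-Sturmian (i.e. $S^m(x)$ is characteristic quasi-Sturmian for some $m \in \mathbb{Z}$), in which case $p_x(n) = n + \mathrm{span}(x)$ for all large enough $n$.
   Context: For integers $j \le k$, $[j,k]$ denotes $\{j, j+1, \dots, k\}$ and $x_{[j,k]} = x_j x_{j+1} \cdots x_k$. A factor of $x$ is a finite word occurring in $x$ at consecutive positions. The factor complexity $p_x(n)$ is the number of distinct length-$n$ factors of $x$. The shift map is $S\colon (x_i)_{i\in\mathbb{Z}} \mapsto (x_{i+1})_{i\in\mathbb{Z}}$. A non-empty factor $w$ of $x$ is captured by $\Gamma \subseteq \mathbb{Z}$ if there is $i$ with $x_{[i,i+|w|-1]} = w$ and $[i,i+|w|-1] \cap \Gamma \ne \emptyset$. $\Gamma$ is a string attractor of $x$ if every non-empty factor of $x$ is captured by $\Gamma$. The span of a set is $\mathrm{span}(\Gamma) = \sup\Gamma - \inf\Gamma$, and $\mathrm{span}(x) = \inf\{\mathrm{span}(\Gamma) \mid \Gamma \text{ a string attractor of } x\}$. A bi-infinite word $x$ is purely periodic if there is $p \ge 1$ with $x_n = x_{n+p}$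 for all $n \in \mathbb{Z}$. It is eventually periodic if there are $p,q \ge 1$ and $N_p, N_q \in \mathbb{Z}$ such that $x_n = x_{n+p}$ for all $n \ge N_p$ and $x_n = x_{n-q}$ for all $n \le N_q$. It is aperiodic if for all $p \ge 1$ and $N \in \mathbb{Z}$ there exist $n \le N$ and $n' \ge N$ with $x_n \ne x_{n+p}$ and $x_{n'} \ne x_{n'+p}$. $x$ is quasi-Sturmian if it is aperiodic and there exist $n_0 \ge 0$, $k \ge 1$ such that $p_x(n) = n+k$ for all $n \ge n_0$. A factor $u$ of $x$ is left-special (resp. right-special) if there are two distinct letters $a,b$ such that $au, bu$ (resp. $ua, ub$) are factors of $x$. A quasi-Sturmian word has, for every large enough $n$, exactly one left-special factor of length $n$, denoted $\ell_n(x)$, and exactly one right-special factor of length $n$, denoted $r_n(x)$. A quasi-Sturmian word $x$ is characteristic if there is a finite word $u$ such that $x_{[-n,n+|u|-1]} = r_n(x)\,u\,\ell_n(x)$ for all $n$ large enough that $r_n(x)$ and $\ell_n(x)$ are defined. *)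

(* Defs.v *)
From mathcomp Require Export all_boot all_order all_algebra.
From mathcomp Require Export boolp classical_sets cardinality constructive_ereal.

Set Implicit Arguments.
Unset Strict Implicit.
Unset Printing Implicit Defensive.

Import Order.TTheory GRing.Theory Num.Theory.
Local Open Scope classical_set_scope.
Local Open Scope ring_scope.

(* A bi-infinite word over [A] is a function [int -> A]. *)

(* The word x_[i, i + n - 1]: it is given by its start and length. *)
Definition window (A : Type) (x : int -> A) (i : int) (n : nat) : seq A :=
  mkseq (fun k : nat => x (i + k%:Z)) n.

(* S^m, for any m in Z; the shift S itself is [shiftZ 1]. *)
Definition shiftZ (A : Type) (m : int) (x : int -> A) : int -> A :=
  fun i => x (i + m).

Definition factor (A : Type) (x : int -> A) (w : seq A) : Prop :=
  exists i : int, window x i (size w) = w.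

Definition complexity (A : finType) (x : int -> A) (n : nat) : nat :=
  #|[pred w : n.-tuple A | `[< factor x w >]]|.

(* Only meant for non-empty [w]: on the empty word the interval is empty. *)
Definition captured (A : Type) (x : int -> A) (G : set int) (w : seq A) : Prop :=
  exists i : int, window x i (size w) = w /\
    [set` `[i, i + (size w)%:Z - 1]] `&` G !=set0.

Definition string_attractor (A : Type) (x : int -> A) (G : set int) : Prop :=
  forall w : seq A, w <> [::] -> factor x w -> captured x G w.

(* Suprema and infima are taken in the extended integers, where every set has
   both; the first arguments are the values on the empty set.  Hence the span of
   an infinite set is +oo. *)
Definition set_span (G : set int) : \bar int :=
  (supremum -oo (EFin @` G) - infimum +oo (EFin @` G))%E.

Definition word_span (A : Type) (x : int -> A) : \bar int :=
  infimum +oo%E [set set_span G | G in string_attractor x].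

Definition has_period (A : Type) (x : int -> A) (p : nat) : Prop :=
  (1 <= p)%N /\ forall n : int, x n = x (n + p%:Z).

Definition purely_periodic (A : Type) (x : int -> A) : Prop :=
  exists p : nat, has_period x p.

Definition minimal_period (A : Type) (x : int -> A) (p : nat) : Prop :=
  has_period x p /\ forall q : nat, has_period x q -> (p <= q)%N.

(* The two tails may have different periods. *)
Definition eventually_periodic (A : Type) (x : int -> A) : Prop :=
  exists (p q : nat) (Np Nq : int),
    [/\ (1 <= p)%N, (1 <= q)%N,
        forall n : int, Np <= n -> x n = x (n + p%:Z) &
        forall n : int, n <= Nq -> x n = x (n - q%:Z)].

(* Stronger than the negation of [eventually_periodic]: neither tail is
   periodic. *)
Definition aperiodic (A : Type) (x : int -> A) : Prop :=
  forall (p : nat) (N : int), (1 <= p)%N ->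
    exists n n' : int, [/\ n <= N, N <= n',
      x n <> x (n + p%:Z) & x n' <> x (n' + p%:Z)].

Definition quasi_Sturmian (A : finType) (x : int -> A) : Prop :=
  aperiodic x /\
  exists n0 k : nat, (1 <= k)%N /\
    forall n : nat, (n0 <= n)%N -> complexity x n = (n + k)%N.

Definition left_special (A : Type) (x : int -> A) (u : seq A) : Prop :=
  factor x u /\
  exists a b : A, [/\ a <> b, factor x (a :: u) & factor x (b :: u)].

Definition right_special (A : Type) (x : int -> A) (u : seq A) : Prop :=
  factor x u /\
  exists a b : A, [/\ a <> b, factor x (rcons u a) & factor x (rcons u b)].

(* [is_ell x n l] says that l_n(x) is defined and equal to [l]; likewise [is_r]
   for r_n(x). *)
Definition is_ell (A : Type) (x : int -> A) (n : nat) (l : seq A) : Prop :=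
  unique (fun u => size u = n /\ left_special x u) l.

Definition is_r (A : Type) (x : int -> A) (n : nat) (r : seq A) : Prop :=
  unique (fun u => size u = n /\ right_special x u) r.

(* A quasi-Sturmian word has l_n and r_n for all large n, so the condition is
   not vacuous.  Small n impose nothing new: when defined, l_n is a prefix of
   l_m and r_n a suffix of r_m for every m >= n at which these are defined. *)
Definition characteristic (A : finType) (x : int -> A) : Prop :=
  quasi_Sturmian x /\
  exists u : seq A, forall (n : nat) (r l : seq A),
    is_r x n r -> is_ell x n l ->
    window x (- n%:Z) (n + size u + n) = r ++ u ++ l.

(* Main.v *)
Require Import Defs.
From mathcomp Require Import zify.

Set Implicit Arguments.
Unset Strict Implicit.
Unset Printing Implicit Defensive.

Import Order.TTheory GRing.Theory Num.Theory.
Local Open Scope classical_set_scope.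
Local Open Scope ring_scope.

(** A finite string attractor may be enlarged to an interval [[a, b]], and such
    an interval is an attractor exactly when each window of [x] of length [n]
    has a copy that starts in [[a - n + 1, b]].  Hence the complexity is at most
    [n + (b - a)].  By Morse and Hedlund it exceeds [n] unless [x] is purely
    periodic, so it is eventually [n + k], and [k] is at most the span.  The
    theorem then asks which words of complexity [n + k] have an attractor, and
    for an attractor whose span is exactly [k].

    Purely periodic words: a period is an attractor.

    Eventually periodic words: if one tail is periodic and there is a finite
    attractor, so is the other tail ([covers_aperiodic]), because the long words
    at the end of the other tail recur either at a bounded distance or inside
    the periodic tail.  Conversely, let [P] be a common period of both tails;
    the first and the last position where [x t] and [x (t + P)] differ mark the
    ends of an attractor in which no long word is met twice
    ([eventually_periodic_covers], [long_distinct]).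

    Aperiodic words: for large [n] there is one right special word and one left
    special word of length [n], each with two extensions.  Given an attractor,
    counting repetitions shows that the right special words all occur ending at
    some fixed position [m - 1] ([right_special_position]), and by symmetry the
    left special ones starting at some fixed position [m']: up to a shift, [x]
    is characteristic.  Conversely, look at [x] as a walk on the graph whose
    vertices are the words of length [n] and whose edges are those of length
    [n + 1].  The portion from the right special vertex at [m - n] to the left
    special vertex at [m'] uses both edges that leave the right special vertex,
    for infinitely many [n] ([right_special_interior]), and then it uses all
    edges ([both_extensions_occurs_in]), so that long words are captured by
    [[m, m' - 1]].  Shorter words follow by descent on the length
    ([covers_of_long]): if the captured copy of an extension of [w] meets the
    interval in its last letter only, then [w] is right special, and its other
    extension is captured as well, at a different place.  Finally the portion
    repeats no edge for large [n] ([characteristic_complexity]), because a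
    repetition forces a closed walk of bounded length; so [m' - 1 - m] is
    exactly [k]. *)

(** * Equality of windows and special positions *)

(** Offsets are integers rather than naturals, so that positions can be
    compared by linear arithmetic alone. *)
Definition agree (A : Type) (x : int -> A) (i j : int) (n : nat) : Prop :=
  forall t : int, 0 <= t < n%:Z -> x (i + t) = x (j + t).

(** Special factors are handled through a position where they occur: windows
    overlap, move and extend by arithmetic on positions. *)
Definition right_special_at (A : Type) (x : int -> A) (i : int) (n : nat) :=
  exists j, agree x i j n /\ x (i + n%:Z) <> x (j + n%:Z).

Definition left_special_at (A : Type) (x : int -> A) (i : int) (n : nat) :=
  exists j, agree x i j n /\ x (i - 1) <> x (j - 1).

Definition mirror (A : Type) (x : int -> A) : int -> A := fun i => x (- i).

Section Agree.
Variables (A : Type) (x : int -> A).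
Implicit Types (i j t u : int) (n m : nat).

Lemma agree_refl i n : agree x i i n. Proof. by []. Qed.

Lemma agree_sym i j n : agree x i j n -> agree x j i n.
Proof. by move=> H t Ht; rewrite H. Qed.

Lemma agree_trans j i k n : agree x i j n -> agree x j k n -> agree x i k n.
Proof. by move=> H K t Ht; rewrite H ?K. Qed.

(** The form in which equality of windows is used: two letters at the same
    place of the two windows. *)
Lemma agree_at i j n t u : agree x i j n ->
  i <= t < i + n%:Z -> u - t = j - i -> x t = x u.
Proof.
move=> H Ht Hu; have -> : t = i + (t - i) by lia.
have -> : u = j + (t - i) by lia.
by apply: H; lia.
Qed.

Lemma agree_intro i j n :
  (forall t, i <= t < i + n%:Z -> x t = x (t + (j - i))) -> agree x i j n.
Proof.
move=> H t Ht; rewrite H; last by lia.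
by congr (x _); lia.
Qed.

Lemma agree_sub i j n i' j' n' : agree x i j n -> i' - j' = i - j ->
  i <= i' -> i' + n'%:Z <= i + n%:Z -> agree x i' j' n'.
Proof.
move=> H E h1 h2; apply: agree_intro => t Ht.
by apply: (agree_at H); lia.
Qed.

Lemma agree_last i j n : agree x i j n.+1 -> x (i + n%:Z) = x (j + n%:Z).
Proof. by move=> H; apply: (agree_at H); lia. Qed.

Lemma agree_init i j n : agree x i j n.+1 -> agree x i j n.
Proof. by move=> H; apply: (agree_sub H); lia. Qed.

Lemma agreeS i j n : agree x i j n -> x (i + n%:Z) = x (j + n%:Z) ->
  agree x i j n.+1.
Proof.
move=> H e; apply: agree_intro => t Ht.
have [tn|tn] : t < i + n%:Z \/ t = i + n%:Z by lia.
  by apply: (agree_at H); lia.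
by rewrite tn e; congr (x _); lia.
Qed.

Lemma agree_pred i j n : agree x i j n -> x (i - 1) = x (j - 1) ->
  agree x (i - 1) (j - 1) n.+1.
Proof.
move=> H e; apply: agree_intro => t Ht.
have [tn|tn] : i <= t \/ t = i - 1 by lia.
  by apply: (agree_at H); lia.
by rewrite tn e; congr (x _); lia.
Qed.

Lemma agree_windowP i j n : window x i n = window x j n <-> agree x i j n.
Proof.
split=> [e t Ht|H].
  have := congr1 (fun s => nth (x 0) s `|t|%N) e.
  rewrite /window !nth_mkseq; try lia.
  by have -> : (`|t|%N)%:Z = t by lia.
apply: (@eq_from_nth _ (x 0)); first by rewrite !size_mkseq.
by rewrite size_mkseq => k Hk; rewrite !nth_mkseq //; apply: H; lia.
Qed.

Lemma right_special_agree i j n :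
  agree x i j n -> right_special_at x i n -> right_special_at x j n.
Proof.
move=> H [k [Hk ne]].
have [e|ne'] := EM (x (j + n%:Z) = x (k + n%:Z)).
  by exists i; split; [exact: agree_sym|rewrite e => e'; apply: ne].
by exists k; split=> //; apply: agree_trans Hk; apply: agree_sym.
Qed.

Lemma left_special_agree i j n :
  agree x i j n -> left_special_at x i n -> left_special_at x j n.
Proof.
move=> H [k [Hk ne]].
have [e|ne'] := EM (x (j - 1) = x (k - 1)).
  by exists i; split; [exact: agree_sym|rewrite e => e'; apply: ne].
by exists k; split=> //; apply: agree_trans Hk; apply: agree_sym.
Qed.

Lemma right_special_suffix i n i' n' : right_special_at x i n ->
  i' + n'%:Z = i + n%:Z -> (n' <= n)%N -> right_special_at x i' n'.
Proof.
move=> [j [H ne]] e le; exists (j + i' - i); split.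
  by apply: (agree_sub H); lia.
by rewrite e; have -> : j + i' - i + n'%:Z = j + n%:Z by lia.
Qed.

Lemma left_special_prefix i n n' :
  left_special_at x i n -> (n' <= n)%N -> left_special_at x i n'.
Proof.
by move=> [j [H ne]] le; exists j; split=> //; apply: (agree_sub H); lia.
Qed.

Lemma agree_mirror i j n i' j' : i' = 1 - n%:Z - i -> j' = 1 - n%:Z - j ->
  agree x i j n -> agree (mirror x) i' j' n.
Proof.
move=> -> -> H; rewrite /agree /mirror => t Ht; apply: (agree_at H); lia.
Qed.

Lemma right_special_mirror i n i' : i' = 1 - n%:Z - i ->
  left_special_at x i n -> right_special_at (mirror x) i' n.
Proof.
move=> -> [j [H ne]]; exists (1 - n%:Z - j); split; first exact: agree_mirror H.
move=> e; apply: ne; move: e; rewrite /mirror.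
have -> : - (1 - n%:Z - i + n%:Z) = i - 1 by lia.
by have -> : - (1 - n%:Z - j + n%:Z) = j - 1 by lia.
Qed.

Lemma left_special_mirror i n i' : i' = 1 - n%:Z - i ->
  right_special_at x i n -> left_special_at (mirror x) i' n.
Proof.
move=> -> [j [H ne]]; exists (1 - n%:Z - j); split; first exact: agree_mirror H.
move=> e; apply: ne; move: e; rewrite /mirror.
have -> : - (1 - n%:Z - i - 1) = i + n%:Z by lia.
by have -> : - (1 - n%:Z - j - 1) = j + n%:Z by lia.
Qed.

End Agree.

Lemma mirrorK (A : Type) (x : int -> A) : mirror (mirror x) = x.
Proof. by apply/funext => i; rewrite /mirror opprK. Qed.

(** * Counting factors by their positions *)

Definition irange (a : int) (c : nat) : seq int :=
  [seq a + k%:Z | k <- iota 0 c].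

Lemma size_irange a c : size (irange a c) = c.
Proof. by rewrite size_map size_iota. Qed.

Lemma mem_irange a c t : (t \in irange a c) = (a <= t < a + c%:Z).
Proof.
apply/mapP/idP => [[k]|Ht]; first by rewrite mem_iota => Hk ->; lia.
by exists `|t - a|%N; rewrite ?mem_iota; lia.
Qed.

Lemma irange_uniq a c : uniq (irange a c).
Proof. by rewrite map_inj_uniq ?iota_uniq // => i j; lia. Qed.

Section Count.
Variables (A : finType) (x : int -> A).
Implicit Types (i j t u a b : int) (n m : nat) (L : seq int).

Definition wtuple i n : n.-tuple A :=
  Tuple (introT eqP (size_mkseq (fun k : nat => x (i + k%:Z)) n)).

Lemma wtupleE i n : wtuple i n = window x i n :> seq A. Proof. by []. Qed.

Lemma wtupleP i j n : wtuple i n = wtuple j n <-> agree x i j n.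
Proof.
rewrite -agree_windowP; split=> [e|e]; last exact: val_inj.
by rewrite -!wtupleE e.
Qed.

Lemma factor_wtuple i n : factor x (wtuple i n).
Proof. by exists i; rewrite size_tuple. Qed.

Lemma complexity_le n L :
  (forall i, exists2 j, j \in L & agree x i j n) ->
  (complexity x n <= size L)%N.
Proof.
move=> H; rewrite -(size_map (wtuple ^~ n)); apply: leq_trans (card_size _).
apply/subset_leq_card/fintype.subsetP => w; rewrite inE => -[i].

rewrite size_tuple => wE; have [j jL Hj] := H i.
apply/mapP; exists j => //; apply/val_inj.
by rewrite /= -wE; apply/agree_windowP.
Qed.

Lemma complexity_reps n : exists L,
  [/\ size L = complexity x n, uniq L,
      {in L &, forall i j, agree x i j n -> i = j} &
      forall i, exists2 j, j \in L & agree x i j n].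
Proof.
pose P (w : n.-tuple A) i := factor x w -> wtuple i n = w.
have /choice[pos posP] : forall w, exists i, P w i.
  move=> w; have [[i wE]|nw] := EM (factor x w); last by exists 0 => /nw.
  by exists i => _; apply/val_inj; rewrite /= -[RHS]wE size_tuple.
pose F := enum [pred w : n.-tuple A | `[< factor x w >]].
have FP w : w \in F -> factor x w by rewrite mem_enum inE.
exists (map pos F); split.
- by rewrite size_map -cardE.
- rewrite map_inj_in_uniq ?enum_uniq // => w w' /FP Fw /FP Fw' e.
  by rewrite -(posP _ Fw) -(posP _ Fw') e.
- move=> _ _ /mapP[w /FP Fw ->] /mapP[w' /FP Fw' ->] /wtupleP.
  by rewrite (posP _ Fw) (posP _ Fw') => ->.
move=> i; exists (pos (wtuple i n)); last first.
  by apply/wtupleP; rewrite posP //; exact: factor_wtuple.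
by apply: map_f; rewrite mem_enum inE; exact: factor_wtuple.
Qed.

Lemma le_complexity n L : uniq L ->
  {in L &, forall i j, agree x i j n -> i = j} -> (size L <= complexity x n)%N.
Proof.
move=> uL H; rewrite -(size_map (wtuple ^~ n)).
have /card_uniqP <- : uniq (map (wtuple ^~ n) L).
  by rewrite map_inj_in_uniq // => i j iL jL /wtupleP; apply: H.
apply/subset_leq_card/fintype.subsetP => _ /mapP[i _ ->]; rewrite inE.
by exact: factor_wtuple.
Qed.

Lemma repeat_in_list n L : uniq L -> (complexity x n < size L)%N ->
  exists i j, [/\ i \in L, j \in L, i < j & agree x i j n].
Proof.
move=> uL lt; apply: contrapT => H.
suff : (size L <= complexity x n)%N by rewrite leqNgt lt.
apply: le_complexity => // i j iL jL ij.
have [e|[h|h]] : i = j \/ (i < j \/ j < i) by lia.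
- by [].
- by case: H; exists i, j.
- by case: H; exists j, i; split=> //; exact: agree_sym.
Qed.

Lemma repeat_in_range n a c : (complexity x n < c)%N ->
  exists i j, [/\ a <= i, i < j, j < a + c%:Z & agree x i j n].
Proof.
move=> lt; have := @repeat_in_list n (irange a c) (irange_uniq a c).
rewrite size_irange => /(_ lt)[i [j []]]; rewrite !mem_irange => hi hj ij H.
by exists i, j; split=> //; lia.
Qed.

Lemma complexity0 : complexity x 0 = 1%N.
Proof.
apply/eqP; rewrite eqn_leq; apply/andP; split.
  by apply: (@complexity_le 0 [:: 0]) => i; exists 0 => // t; lia.
apply: (@le_complexity 0 [:: 0]) => // i j.
by rewrite !inE => /eqP-> /eqP->.
Qed.

Definition separated n L := {in L &, forall i j, agree x i j n -> i = j}.

Definition exhaustive n L := forall i, exists2 j, j \in L & agree x i j n.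

(** The words of length [n + 1] at representatives of the words of length [n]
    are distinct; any further words found at [E] are in excess. *)
Lemma complexity_extend n L E : uniq L -> separated n L ->
  uniq E -> separated n.+1 E ->
  {in E & L, forall s r, ~ agree x s r n.+1} ->
  (size L + size E <= complexity x n.+1)%N.
Proof.
move=> uL sL uE sE EL; rewrite -size_cat; apply: le_complexity.
  rewrite cat_uniq uL uE andbT; apply/hasPn => s sE'; apply/negP => sL'.
  by apply: (EL s s).
move=> u v; rewrite !mem_cat => /orP[uin|uin] /orP[vin|vin] H.
- by apply: sL => //; exact: agree_init.
- by case: (EL v u) => //; exact: agree_sym.
- by case: (EL u v).
- exact: sE.
Qed.

Lemma not_rep n L r s : separated n L -> r \in L -> agree x r s n ->
  x (s + n%:Z) <> x (r + n%:Z) -> forall r', r' \in L -> ~ agree x s r' n.+1.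
Proof.
move=> sL rL rs ne r' r'L H.
have e : r = r'.
  by apply: sL => //; apply: agree_trans rs _; exact: agree_init.
by apply: ne; rewrite e; exact: agree_last.
Qed.

(** Of the two extensions of a right special word, one is not the extension
    seen at its representative, so it is missed by all representatives. *)
Lemma other_extension n L i : separated n L -> exhaustive n L ->
  right_special_at x i n ->
  exists s, agree x i s n /\ forall r, r \in L -> ~ agree x s r n.+1.
Proof.
move=> sL cL [j [ij ne]]; have [r rL ir] := cL i.
have [e|ne'] := EM (x (i + n%:Z) = x (r + n%:Z)).
  exists j; split=> //; apply: (not_rep sL rL).
    exact: agree_trans (agree_sym ir) ij.
  by rewrite -e => e'; apply: ne.
exists i; split=> //; apply: (not_rep sL rL) => //; exact: agree_sym.
Qed.

Lemma complexity_ltS i n :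
  right_special_at x i n -> (complexity x n < complexity x n.+1)%N.
Proof.
have [L [<- uL sL cL]] := complexity_reps n.
move=> /(other_extension sL cL)[s [_ sP]]; rewrite -addn1.
apply: (@complexity_extend n L [:: s]) => //.
  by move=> u v; rewrite !inE => /eqP-> /eqP->.
by move=> u v; rewrite inE => /eqP->; apply: sP.
Qed.

(** Two distinct right special words, or (in the next lemma) three extensions of the
    same word, would give two words of length [n + 1] in excess. *)
Lemma right_special_unique i j n :
  (complexity x n.+1 <= (complexity x n).+1)%N ->
  right_special_at x i n -> right_special_at x j n -> agree x i j n.
Proof.
have [L [<- uL sL cL]] := complexity_reps n; move=> le.
move=> /(other_extension sL cL)[s [si sP]] /(other_extension sL cL)[t [tj tP]].
have [H|H] := EM (agree x s t n.+1).
  apply: agree_trans si _; apply: agree_trans (agree_sym tj).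
  exact: agree_init.
suff : (size L + 2 <= complexity x n.+1)%N by lia.
apply: (@complexity_extend n L [:: s; t]) => //.
- rewrite /= inE andbT; apply/eqP => e; apply: H; rewrite e; exact: agree_refl.
- move=> u v; rewrite !inE => /orP[] /eqP-> /orP[] /eqP-> // K.
  by case: H; exact: agree_sym.
- by move=> u v; rewrite !inE => /orP[] /eqP->; [apply: sP|apply: tP].
Qed.

Lemma two_extensions i j k n :
  (complexity x n.+1 <= (complexity x n).+1)%N ->
  agree x i j n -> agree x i k n ->
  [\/ x (i + n%:Z) = x (j + n%:Z), x (i + n%:Z) = x (k + n%:Z) |
      x (j + n%:Z) = x (k + n%:Z)].
Proof.
have [L [<- uL sL cL]] := complexity_reps n; move=> le aij aik.
have [r rL ir] := cL i.
have two s t : agree x i s n -> agree x i t n ->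
    x (s + n%:Z) <> x (r + n%:Z) -> x (t + n%:Z) <> x (r + n%:Z) ->
    x (s + n%:Z) = x (t + n%:Z).
  move=> ais ait asr atr; apply: contrapT => st.
  suff : (size L + 2 <= complexity x n.+1)%N by lia.
  apply: (@complexity_extend n L [:: s; t]) => //.
  - by rewrite /= inE andbT; apply/eqP => e; apply: st; rewrite e.
  - by move=> u v; rewrite !inE => /orP[] /eqP-> /orP[] /eqP-> // /agree_last;
      [move=> /st | move=> /esym/st].
  - have := not_rep sL rL; move: ais ait asr atr => /(agree_trans (agree_sym ir)) h1.
    move=> /(agree_trans (agree_sym ir)) h2 h3 h4 H u v.
    by rewrite !inE => /orP[] /eqP-> vL; apply: (H _ _ _ _ vL).
have [ei|ni] := EM (x (i + n%:Z) = x (r + n%:Z)).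
  have [ej|nj] := EM (x (j + n%:Z) = x (r + n%:Z)).
    by constructor 1; rewrite ei ej.
  have [ek|nk] := EM (x (k + n%:Z) = x (r + n%:Z)).
    by constructor 2; rewrite ei ek.
  by constructor 3; apply: two.
have [ej|nj] := EM (x (j + n%:Z) = x (r + n%:Z)).
  have [ek|nk] := EM (x (k + n%:Z) = x (r + n%:Z)).
    by constructor 3; rewrite ek ej.
  by constructor 2; apply: two.
by constructor 1; apply: two.
Qed.

End Count.

Lemma complexity_mirror (A : finType) (x : int -> A) n :
  complexity (mirror x) n = complexity x n.
Proof.
have le y : (complexity (A := A) (mirror y) n <= complexity y n)%N.
  have [L [<- _ _ cL]] := complexity_reps y n.
  rewrite -(size_map (fun i : int => 1 - n%:Z - i)).
  apply: complexity_le => i; have [j jL H] := cL (1 - n%:Z - i).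
  exists (1 - n%:Z - j); first exact: map_f.
  by apply: agree_mirror H; lia.
by apply/eqP; rewrite eqn_leq le -{1}(mirrorK x) le.
Qed.

(** * Aperiodic words and attractors *)

Definition aperiodic_right (A : Type) (x : int -> A) : Prop :=
  forall (p : nat) (N : int), (1 <= p)%N ->
    exists n, N <= n /\ x n <> x (n + p%:Z).

Definition aperiodic_left (A : Type) (x : int -> A) : Prop :=
  forall (p : nat) (N : int), (1 <= p)%N ->
    exists n, n <= N /\ x n <> x (n + p%:Z).

Definition occurs_in (A : Type) (x : int -> A) (n : nat) (lo hi : int) :=
  forall i, exists j, lo <= j <= hi /\ agree x i j n.

(** A window of length [n] meets [[a, b]] when it starts in
    [[a - n + 1, b]], so this says that the interval is a string attractor. *)
Definition covers (A : Type) (x : int -> A) (a b : int) : Prop :=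
  forall n : nat, (1 <= n)%N -> occurs_in x n (a - n%:Z + 1) b.

(** Used in contraposition: if a property persists for infinitely many [n] at
    some place of a bounded range, it does so at one fixed place. *)
Lemma eventually_uniform (lo hi : int) (P : int -> nat -> Prop) :
  (forall d, lo <= d <= hi -> exists n, forall n', (n <= n')%N -> P d n') ->
  exists n, forall n', (n <= n')%N -> forall d, lo <= d <= hi -> P d n'.
Proof.
move=> H; suff K c : exists n, forall n', (n <= n')%N ->
    forall d, lo <= d <= hi -> d < lo + c%:Z -> P d n'.
  have [n Hn] := K `|(hi - lo + 1)%R|%N; exists n => n' le d Hd.
  by apply: Hn => //; lia.
elim: c => [|c [n IH]]; first by exists 0%N => n' _ d; lia.
have [Hc|Hc] := EM (lo <= lo + c%:Z <= hi); last first.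
  by exists n => n' le d Hd Hdc; apply: IH => //; lia.
have [n2 Hn2] := H _ Hc; exists (maxn n n2) => n' le d Hd Hdc.
have [e|lt] : d = lo + c%:Z \/ d < lo + c%:Z by lia.
  by rewrite e; apply: Hn2; lia.
by apply: IH => //; lia.
Qed.

Lemma aperiodic_right_mirror (A : Type) (x : int -> A) :
  aperiodic_left x -> aperiodic_right (mirror x).
Proof.
move=> H p N p1; have [n [nN ne]] := H p (- N - p%:Z) p1.
exists (- n - p%:Z); split; first by lia.
rewrite /mirror => e; apply: ne; have -> : n = - (- n - p%:Z + p%:Z) by lia.
by rewrite -e; congr (x _); lia.
Qed.

Lemma aperiodic_left_mirror (A : Type) (x : int -> A) :
  aperiodic_right x -> aperiodic_left (mirror x).
Proof.
move=> H p N p1; have [n [nN ne]] := H p (- N - p%:Z) p1.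
exists (- n - p%:Z); split; first by lia.
rewrite /mirror => e; apply: ne; have -> : n = - (- n - p%:Z + p%:Z) by lia.
by rewrite -e; congr (x _); lia.
Qed.

Lemma occurs_in_mirror (A : Type) (x : int -> A) n lo hi :
  occurs_in x n lo hi -> occurs_in (mirror x) n (1 - n%:Z - hi) (1 - n%:Z - lo).
Proof.
move=> H i; have [j [jlh ij]] := H (1 - n%:Z - i).
exists (1 - n%:Z - j); split; first by lia.
by apply: agree_mirror ij; lia.
Qed.

Lemma covers_mirror (A : Type) (x : int -> A) a b :
  covers x a b -> covers (mirror x) (- b) (- a).
Proof.
move=> H n n1; have := occurs_in_mirror (H n n1).
have -> : 1 - n%:Z - (a - n%:Z + 1) = - a by lia.
by have -> : 1 - n%:Z - b = - b - n%:Z + 1 by lia.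
Qed.

Section Aperiodic.
Variables (A : finType) (x : int -> A).
Implicit Types (i j t u a b : int) (n m : nat).

Lemma first_break i j n : aperiodic_right x -> i < j -> agree x i j n ->
  exists G, [/\ (n <= G)%N, agree x i j G & x (i + G%:Z) <> x (j + G%:Z)].
Proof.
move=> ap ij H; have [|t [ti ne]] := ap `|(j - i)%R|%N (i + n%:Z); first by lia.
pose P g := (n <= g)%N && (x (i + g%:Z) != x (j + g%:Z)).
have exP : exists g, P g.
  exists `|(t - i)%R|%N; apply/andP; split; first by lia.
  apply/eqP => e; apply: ne.
  have -> : t = i + (`|(t - i)%R|%N)%:Z by lia.
  by rewrite e; congr (x _); lia.
case: (ex_minnP exP) => G /andP[nG /eqP neG] minG; exists G; split=> //.
apply: agree_intro => s Hs; have [lt|ge] : s < i + n%:Z \/ i + n%:Z <= s by lia.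
  by apply: (agree_at H); lia.
apply/eqP/negPn/negP => nes; suff : (G <= `|(s - i)%R|%N)%N by lia.
apply: minG; apply/andP; split; first by lia.
move: nes; have -> : i + (`|(s - i)%R|%N)%:Z = s by lia.
by have -> : j + (`|(s - i)%R|%N)%:Z = s + (j - i) by lia.
Qed.

(** A walk that comes back to the same vertex without meeting a vertex with
    several successors goes round for ever, which is excluded on an aperiodic
    tail. *)
Lemma right_special_between i j n : aperiodic_right x -> i < j ->
  agree x i j n -> exists t, i <= t < j /\ right_special_at x t n.
Proof.
move=> ap ij H; have [G [nG HG neG]] := first_break ap ij H.
have rsG : right_special_at x (i + (G - n)%N%:Z) n.
  apply: (@right_special_suffix _ _ i G); [by exists j| lia | lia].
have : (n + (G - n) <= G)%N by lia.
move: (G - n)%N rsG => s; have [k] := ubnP s; elim: k s => // k IH s sk rs le.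
have [lt|ge] : (s%:Z < j - i \/ j - i <= s%:Z) by lia.
  by exists (i + s%:Z); split=> //; lia.
apply: (IH (s - `|(j - i)%R|%N)%N); [lia| |lia].
apply: right_special_agree rs; apply: agree_sym.
apply: (agree_sub HG); lia.
Qed.

Lemma occurs_in_complexity n lo hi : occurs_in x n lo hi ->
  (complexity x n)%:Z <= hi - lo + 1.
Proof.
move=> H; have [j0 [j0P _]] := H 0.
suff : (complexity x n <= `|(hi - lo + 1)%R|%N)%N by lia.
rewrite -(size_irange lo `|(hi - lo + 1)%R|%N); apply: complexity_le => i.
by have [j [jP ij]] := H i; exists j => //; rewrite mem_irange; lia.
Qed.

(** The words of length [n] that start at [s], ..., [s + g] are found again
    [t - s] further on, so these [g + 1] starting points can be dropped. *)
Lemma occurs_in_repeat n g lo hi s t : occurs_in x n lo hi ->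
  agree x s t (n + g) -> lo <= s -> s < t -> t + g%:Z <= hi ->
  (complexity x n)%:Z + g%:Z <= hi - lo.
Proof.
move=> H st los lt tg.
suff : (complexity x n <= `|(s - lo)%R|%N + `|(hi - s - g%:Z)%R|%N)%N by lia.
rewrite -(size_irange lo `|(s - lo)%R|%N).
rewrite -(size_irange (s + g%:Z + 1) `|(hi - s - g%:Z)%R|%N) -size_cat.
apply: complexity_le => i; have [j [jP ij]] := H i.
(* Jump by [t - s] until the position leaves [[s, s + g]]. *)
suff [j' [j'P jj']] : exists j', ((lo <= j' < s) || (s + g%:Z < j' <= hi)) /\
    agree x j j' n.
  exists j'; last exact: agree_trans ij jj'.
  by rewrite mem_cat !mem_irange; lia.
have [k] := ubnP `|(hi - j)%R|%N; elim: k j jP {ij} => // k IH j jP jk.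
have [Hj|Hj] := EM (s <= j <= s + g%:Z); last first.
  by exists j; split; [lia|exact: agree_refl].
have jj : agree x j (j + (t - s)) n by apply: (agree_sub st); lia.
have [||j' [j'P jj']] := IH (j + (t - s)); try lia.
by exists j'; split=> //; apply: agree_trans jj jj'.
Qed.

(** If no word of length [n] is right special, then each word of length [n]
    determines the future.  Some word repeats within [K] steps, where [K] is
    the number of words, so the future of any point has a period at most [K],
    hence the common period [K`!]. *)
Lemma right_special_exists n :
  ~ purely_periodic x -> exists i, right_special_at x i n.
Proof.
move=> np; apply: contrapT => norsp; apply: np.
have ext i j m : agree x i j n -> agree x i j (n + m).
  move=> H; elim: m => [|m IH]; first by rewrite addn0.
  rewrite addnS; apply: agreeS => //; apply: contrapT => ne; apply: norsp.
  exists (i + m%:Z); apply: (@right_special_suffix _ _ i (n + m)%N); try lia.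
  by exists j.
pose K := complexity x n; exists K`!; split; first by rewrite fact_gt0.
move=> s; have [i [j [h1 h2 h3 ij]]] := @repeat_in_range _ x n (s - K%:Z) K.+1 (ltnSn _).
have per t : s <= t -> x t = x (t + (j - i)).
  move=> st; apply: (agree_at (ext i j `|(t - i)%R|%N.+1 ij)); lia.
have dv : (`|(j - i)%R|%N %| K`!)%N by apply: dvdn_fact; lia.
suff pers c : x s = x (s + (c * `|(j - i)%R|%N)%N%:Z).
  by rewrite -(divnK dv); apply: pers.
elim: c => [|c ->]; first by rewrite mul0n addr0.
by rewrite per; [congr (x _); lia | lia].
Qed.

Lemma complexity_lt n :
  ~ purely_periodic x -> (complexity x n < complexity x n.+1)%N.
Proof. by case/(right_special_exists n) => i; apply: complexity_ltS. Qed.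

(** The theorem of Morse and Hedlund for bi-infinite words. *)
Lemma complexity_gt n : ~ purely_periodic x -> (n < complexity x n)%N.
Proof.
move=> np; elim: n => [|n IH]; first by rewrite complexity0.
exact: leq_ltn_trans IH (complexity_lt n np).
Qed.

Lemma aperiodic_not_periodic : aperiodic_right x -> ~ purely_periodic x.
Proof. by move=> ap [p [p1 per]]; have [n [_ []]] := ap p 0 p1. Qed.

(** Suppose that the right tail has period [p] and consider the words that end
    at [a - 1].  Once such a word contains a place where the period [p] fails,
    its copy captured by [[a, b]] has to keep that place out of the periodic
    tail, so it is shifted by a bounded distance [d].  The same [d] serves for
    all lengths, and the left tail has period [d]. *)
Lemma covers_aperiodic a b : covers x a b -> aperiodic_left x -> aperiodic_right x.
Proof.
move=> cov apl; apply: contrapT => napr.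
have [p [N [p1 per]]] : exists (p : nat) (N : int),
    (1 <= p)%N /\ forall t, N <= t -> x t = x (t + p%:Z).
  apply: contrapT => H; apply: napr => p N p1; apply: contrapT => K.
  apply: H; exists p, N; split=> // t Nt; apply: contrapT => ne.
  by apply: K; exists t.
(* Here the period [p] fails to the left of [a]. *)
have [t [ta net]] := apl p (a - 1 - p%:Z) p1.
pose P d n := ~ agree x (a - n%:Z) (a - n%:Z + d) n.
have [d [dP Hd]] : exists d, 1 <= d <= N - t - 1 /\ forall n,
    agree x (a - n%:Z) (a - n%:Z + d) n.
  apply: contrapT => H.
  have [n Hn] : exists n, forall n', (n <= n')%N -> forall d,
      1 <= d <= N - t - 1 -> P d n'.
    apply: eventually_uniform => d dP.
    have [n Hn] : exists n, P d n.
      apply: contrapT => K; apply: H; exists d; split=> // n.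
      by apply: contrapT => nag; apply: K; exists n.
    exists n => n' le K; apply: Hn; apply: (agree_sub K); lia.
  pose n' := maxn n `|(a - t)%R|%N.+1.
  have [|j [jP jH]] := cov n' _ (a - n'%:Z); first by lia.
  have jd : j = a - n'%:Z + (j - (a - n'%:Z)) by lia.
  apply: (Hn n' _ (j - (a - n'%:Z))); [lia| |by rewrite /P -jd].
  suff : t + (j - (a - n'%:Z)) < N by lia.
  rewrite ltNge; apply/negP => ge; apply: net.
  rewrite (agree_at jH (u := t + (j - (a - n'%:Z)))); try lia.
  rewrite [RHS](agree_at jH (u := t + p%:Z + (j - (a - n'%:Z)))); try lia.
  by rewrite per //; congr (x _); lia.
have [n [na ne]] := apl `|d|%N (a - 1) ltac:(lia).
by apply: ne; apply: (agree_at (Hd `|(a - n)%R|%N.+1)); lia.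
Qed.

(** Equal words of all lengths at two fixed positions would make the right tail
    periodic. *)
Lemma no_repeat_right C D : aperiodic_right x -> exists n, forall n',
  (n <= n')%N -> forall s t, C <= s -> s < t -> t <= D -> ~ agree x s t n'.
Proof.
move=> ap.
have [n Hn] : exists n, forall n', (n <= n')%N -> forall s, C <= s <= D ->
    forall t, s < t -> t <= D -> ~ agree x s t n'.
  apply: eventually_uniform => s sP.
  have [n Hn] : exists n, forall n', (n <= n')%N -> forall t,
      s + 1 <= t <= D -> ~ agree x s t n'.
    apply: eventually_uniform => t tP.
    have [|m [sm ne]] := ap `|(t - s)%R|%N s; first by lia.
    exists `|(m - s)%R|%N.+1 => n' le H; apply: ne.
    by rewrite (agree_at H (u := m + (t - s))); [congr (x _); lia| lia| lia].
  by exists n => n' le t st tD; apply: Hn => //; lia.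
by exists n => n' le s t Cs st tD; apply: (Hn n') => //; lia.
Qed.

(** The captured copies of the two extensions of the right special word of
    length [n] provide two starts [s n < t n] of that word, at most [b].  If no
    [m] existed, then these copies would end farther and farther to the right.
    Moreover [t n] goes to the left for infinitely many [n], because otherwise
    the right special words of lengths [n] and [n + D] would start at bounded
    positions, which makes the right tail periodic.  So for some large [n] the
    repetition at [s n] and [t n] has ample room on both sides of [[a, b]], and
    it leaves at most [n'] words of a length [n'], against Morse and Hedlund. *)
Lemma right_special_position a b n0 : covers x a b -> aperiodic_right x ->
  (forall n, (n0 <= n)%N -> (complexity x n.+1 <= (complexity x n).+1)%N) ->
  exists m : int, forall n, right_special_at x (m - n%:Z) n.
Proof.
move=> cov ap cS; apply: contrapT => nom.
have np := aperiodic_not_periodic ap.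
have uRS n i j : (n0 <= n)%N -> right_special_at x i n ->
    right_special_at x j n -> agree x i j n.
  by move=> le; apply: right_special_unique; apply: cS.
(* Right special words eventually avoid each fixed right end. *)
have far B : exists n, forall n', (n <= n')%N -> forall e, a <= e <= B ->
    ~ right_special_at x (e - n'%:Z) n'.
  apply: eventually_uniform => e eP.
  have [n Hn] : exists n, ~ right_special_at x (e - n%:Z) n.
    apply: contrapT => K; apply: nom; exists e => n.
    by apply: contrapT => K'; apply: K; exists n.
  by exists n => n' le rs; apply: Hn; apply: right_special_suffix rs _ _; lia.
have pairs n : exists s t, [/\ a - n%:Z <= s, s < t, t <= b, agree x s t n &
    right_special_at x s n].
  have [i [j [ij ne]]] := right_special_exists n np.
  have [s [sP si]] := cov n.+1 isT i; have [t [tP tj]] := cov n.+1 isT j.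
  have nest : x (s + n%:Z) <> x (t + n%:Z).
    by rewrite -(agree_last si) -(agree_last tj).
  have st : agree x s t n.
    apply: agree_trans (agree_init tj).
    by apply: agree_trans ij; apply: agree_sym; apply: agree_init.
  have [e|[lt|gt]] : s = t \/ (s < t \/ t < s) by lia.
  - by case: nest; rewrite e.
  - by exists s, t; split=> //; [lia|lia|exists t].
  exists t, s; split=> //; [lia|lia|exact: agree_sym|].
  by exists s; split; [exact: agree_sym|move=> e; apply: nest].
have nrr := no_repeat_right _ _ ap.
have /choice[s /choice[t stP]] := pairs.
have ts n : right_special_at x (t n) n.
  by have [_ _ _ h1 h2] := stP n; apply: right_special_agree h2.
(* The later start lies to the left of [a] for infinitely many lengths. *)
have tfar N : exists n, (N <= n)%N /\ t n < a.
  apply: contrapT => K.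
  have tC n : (N <= n)%N -> a <= t n.
    by move=> le; rewrite leNgt; apply/negP => lt; apply: K; exists n.
  pose D := `|(b - a)%R|%N.+1.
  have [n1 Hn1] := nrr a (b + D%:Z).
  pose n := maxn n1 (maxn n0 N).
  have [_ _ h1 _ _] := stP n; have [_ _ h2 _ _] := stP (n + D)%N.
  have h3 := tC n ltac:(lia); have h4 := tC (n + D)%N ltac:(lia).
  (* The suffix of length [n] of the word at [t (n + D)] starts after [b]. *)
  apply: (Hn1 n ltac:(lia) (t n) (t (n + D)%N + D%:Z)); try lia.
  apply: uRS => //; first by lia.
  by apply: right_special_suffix (ts (n + D)%N) _ _; lia.
pose D := `|(b - a)%R|%N.+1.
have [n1 Hn1] := far (a + D%:Z + 1).
have [n [le tn]] := tfar (maxn n1 (D + 1)%N).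
have [h1 h2 h3 h4 h5] := stP n.
have h6 : a + D%:Z + 1 < s n + n%:Z.
  rewrite ltNge; apply/negP => K; apply: (Hn1 n _ (s n + n%:Z)); try lia.
  by have -> : s n + n%:Z - n%:Z = s n by lia.
have ab : a <= b.
  have := occurs_in_complexity (cov 1%N isT).
  by have := complexity_gt 1 np; lia.
have cn := complexity_gt (n - `|(b - a)%R|%N)%N np.
have := @occurs_in_repeat (n - `|(b - a)%R|%N)%N `|(b - a)%R|%N _ _ (s n) (t n)
  (cov (n - `|(b - a)%R|%N)%N ltac:(lia)).
have -> : (n - `|(b - a)%R|%N + `|(b - a)%R|%N = n)%N by lia.
move=> /(_ h4) rep; have := rep ltac:(lia) h2 ltac:(lia); lia.
Qed.

End Aperiodic.

(** * Left special words, by reflection *)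

Section LeftVersions.
Variables (A : finType) (x : int -> A).
Implicit Types (i j k : int) (n : nat).

Lemma left_special_unique i j n :
  (complexity x n.+1 <= (complexity x n).+1)%N ->
  left_special_at x i n -> left_special_at x j n -> agree x i j n.
Proof.
rewrite -!(complexity_mirror x) => le.
move=> /(right_special_mirror erefl) hi /(right_special_mirror erefl) hj.
have := agree_mirror erefl erefl (right_special_unique le hi hj).
rewrite mirrorK; have -> : 1 - n%:Z - (1 - n%:Z - i) = i by lia.
by have -> : 1 - n%:Z - (1 - n%:Z - j) = j by lia.
Qed.

Lemma two_left_extensions i j k n :
  (complexity x n.+1 <= (complexity x n).+1)%N ->
  agree x i j n -> agree x i k n ->
  [\/ x (i - 1) = x (j - 1), x (i - 1) = x (k - 1) | x (j - 1) = x (k - 1)].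
Proof.
rewrite -!(complexity_mirror x) => le ij ik.
have := two_extensions le (agree_mirror erefl erefl ij)
  (agree_mirror erefl erefl ik).
rewrite /mirror.
have e l : - (1 - n%:Z - l + n%:Z) = l - 1 by lia.
by rewrite !e.
Qed.

Lemma left_special_between i j n : aperiodic_left x -> i < j ->
  agree x i j n -> exists t, i < t <= j /\ left_special_at x t n.
Proof.
move=> ap ij H.
have [|t [tij rs]] := right_special_between (aperiodic_right_mirror ap) _
  (agree_mirror erefl erefl (agree_sym H)); first by lia.
exists (1 - n%:Z - t); split; first by lia.
by rewrite -(mirrorK x); apply: left_special_mirror rs.
Qed.

Lemma first_break_left i j n : aperiodic_left x -> i < j -> agree x i j n ->
  exists f : nat, agree x (i - f%:Z) (j - f%:Z) (n + f) /\
    x (i - f%:Z - 1) <> x (j - f%:Z - 1).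
Proof.
move=> ap ij H.
have [|G [nG HG neG]] := first_break (aperiodic_right_mirror ap) _
  (agree_mirror erefl erefl (agree_sym H)); first by lia.
exists (G - n)%N; split.
  rewrite -(mirrorK x); have -> : (n + (G - n) = G)%N by lia.
  by apply: (agree_mirror _ _ (agree_sym HG)); lia.
move=> e; apply: neG; rewrite /mirror.
have -> : - (1 - n%:Z - j + G%:Z) = j - (G - n)%N%:Z - 1 by lia.
by rewrite -e; congr (x _); lia.
Qed.

End LeftVersions.

(** Descent on the length.  Let [w] be a word of length [n] whose extension is
    captured.  Then so is [w], unless its copy is the window that ends at
    [a - 1]; but that window is right special, and its other extension is
    captured elsewhere. *)
Lemma covers_of_long (A : Type) (x : int -> A) (a b : int) :
  (forall n, right_special_at x (a - n%:Z) n) ->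
  (forall N, exists L, (N <= L)%N /\ occurs_in x L.+1 (a - L%:Z) b) ->
  covers x a b.
Proof.
move=> rs occ.
have step n : occurs_in x n.+1 (a - n%:Z) b -> occurs_in x n (a - n%:Z + 1) b.
  move=> H i; have [j [jP ij]] := H i.
  have [lt|e] : a - n%:Z < j \/ j = a - n%:Z by lia.
    by exists j; split; [lia|exact: agree_init].
  have [u [ru]] := rs n; rewrite subrK => ne.
  have [v [vP uv]] := H u; exists v; split.
    have [//|e'] : a - n%:Z + 1 <= v <= b \/ v = a - n%:Z by lia.
    by case: ne; have := agree_last uv; rewrite e' subrK.
  apply: agree_trans (agree_init uv); apply: agree_trans ru.
  by rewrite -e; exact: agree_init.
move=> n n1; have [L [nL HL]] := occ n.
have H : occurs_in x (n + (L - n)).+1 (a - (n + (L - n))%N%:Z) b.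
  by have -> : (n + (L - n) = L)%N by lia.
elim: (L - n)%N H => [|d IH] H; first by move: H; rewrite addn0; apply: step.
apply: IH; move: (step _ H); rewrite addnS.
by have -> : a - (n + d).+1%:Z + 1 = a - (n + d)%N%:Z by lia.
Qed.

(** * Words whose special factors are found at fixed positions *)

Section Characteristic.
Variables (A : finType) (x : int -> A) (n0 k : nat) (m m' : int).
Hypotheses (apr : aperiodic_right x) (apl : aperiodic_left x).
Hypothesis cxE : forall n, (n0 <= n)%N -> complexity x n = (n + k)%N.
Hypothesis rinf : forall n, right_special_at x (m - n%:Z) n.
Hypothesis linf : forall n, left_special_at x m' n.
Implicit Types (i j t : int) (n : nat).

(* In the comments of this section, the graph of order [n] has the words of
   length [n] as vertices and those of length [n + 1] as edges; [r] and [l]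
   are its right and left special vertices, found at [m - n] and at [m']. *)

Let cS n : (n0 <= n)%N -> (complexity x n.+1 <= (complexity x n).+1)%N.
Proof. by move=> le; rewrite !cxE; lia. Qed.

Let uRS n i : (n0 <= n)%N -> right_special_at x i n -> agree x (m - n%:Z) i n.
Proof. by move=> le; apply: right_special_unique (rinf n); apply: cS. Qed.

Let uLS n i : (n0 <= n)%N -> left_special_at x i n -> agree x m' i n.
Proof. by move=> le; apply: left_special_unique (linf n); apply: cS. Qed.

(** A long run of period [g] stops on the right at a right special word, so long
    right special words would have period [g], and with them the left tail. *)
Lemma no_short_period (c : nat) : exists N, forall n, (N <= n)%N ->
  forall g, 1 <= g <= c%:Z -> forall i, ~ agree x i (i + g) n.
Proof.
apply: eventually_uniform => g gP.
have [|t [tm ne]] := apl (p := `|g|%N) (m - 1 - g); first by lia.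
exists (maxn n0 `|(m - t)%R|%N) => n le i H.
have [|G [nG HG neG]] := first_break apr _ H; first by lia.
have mi : agree x (m - G%:Z) i G by apply: uRS; [lia | exists (i + g)].
apply: ne; pose s := t + (i - (m - G%:Z)).
rewrite (agree_at mi (u := s)) /s; try lia.
rewrite (agree_at HG (u := s + g)) /s; try lia.
rewrite [RHS](agree_at mi (u := s + g)) /s //; lia.
Qed.

(** Otherwise the walk from [r] to [l] meets neither [r] nor [l] in between, its
    vertices are distinct, and at most [c] vertices remain.  The walk that
    leaves [r] by the other edge, at [j], cannot enter this path before it
    comes back to [r], because the only way in is through [r]; so it closes up
    within [c] steps, which gives a short period. *)
Lemma right_special_interior : exists N, forall n, (N <= n)%N ->
  exists t, m - n%:Z < t < m' /\ agree x (m - n%:Z) t n.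
Proof.
pose c := `|(k%:Z + 1 - (m' - m))%R|%N.
have [N HN] := no_short_period c.
exists (maxn (maxn N n0) `|(m' - m)%R|.+2) => n le.
apply: contrapT => K.
have nint t : m - n%:Z < t < m' -> ~ agree x (m - n%:Z) t n.
  by move=> tP H; apply: K; exists t.
have nRS t : m - n%:Z < t < m' -> ~ right_special_at x t n.
  by move=> tP rs; apply: (nint t tP); apply: uRS => //; lia.
have dist i j : m - n%:Z < i -> i < j -> j <= m' -> ~ agree x i j n.
  move=> h1 h2 h3 H; have [t [tP rs]] := right_special_between apr h2 H.
  by apply: (nRS t) => //; lia.
have nLS t : m - n%:Z < t < m' -> ~ left_special_at x t n.
  move=> tP ls; apply: (dist t m'); try lia.
  by apply: agree_sym; apply: uLS => //; lia.
have [j [jr]] := rinf n; rewrite subrK => nej.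
(* Trace the path back from a place where the walk from [j] would enter it. *)
have back (s : nat) i : m - n%:Z < i < m' -> (s <= c)%N ->
    ~ agree x (j + s%:Z) i n.
  move=> iP sc H.
  have B g : g%:Z <= i - (m - n%:Z) ->
      agree x (j + s%:Z - g%:Z) (i - g%:Z) n.
    elim: g => [|g IH] gP; first by rewrite !subr0.
    have {IH} := IH ltac:(lia) => IH.
    suff e : x (j + s%:Z - g%:Z - 1) = x (i - g%:Z - 1).
      by apply: (agree_sub (agree_pred IH e)); lia.
    apply: contrapT => ne; apply: (nLS (i - g%:Z)); first by lia.
    exists (j + s%:Z - g%:Z); split; first exact: agree_sym.
    by move=> e; apply: ne.
  (* Back at [r] the walk either has closed up, or left by the wrong edge. *)
  pose g0 := `|(i - (m - n%:Z))%R|%N.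
  have [lt|[e|gt]] : (g0 < s \/ s = g0 \/ s < g0)%N by lia.
  - apply: (HN n ltac:(lia) (s%:Z - g0%:Z) ltac:(lia) j).
    apply: agree_trans (agree_sym jr) _; apply: agree_sym.
    by apply: (agree_sub (B g0 ltac:(lia))); lia.
  - apply: nej; apply: esym.
    by apply: (agree_at (B (g0 - 1)%N ltac:(lia))); lia.
  - apply: (nint (i - s%:Z)); first by lia.
    apply: agree_trans jr _.
    by apply: (agree_sub (B s ltac:(lia))); lia.
pose L := irange (m - n%:Z + 1) `|(m' - m + n%:Z - 1)%R|%N ++ irange j c.+1.
have uL : uniq L.
  rewrite cat_uniq !irange_uniq andTb andbT; apply/hasPn => t.
  rewrite !mem_irange => tP; apply/negP => tQ.
  apply: (back `|(t - j)%R|%N t); [lia|lia|].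
  by have -> : j + (`|(t - j)%R|%N)%:Z = t by lia.
have [|u [v [uin vin uv H]]] := @repeat_in_list _ x n L uL.
  by rewrite size_cat !size_irange cxE; lia.
move: uin vin; rewrite !mem_cat !mem_irange => /orP[uP|uP] /orP[vP|vP].
- by apply: (dist u v) => //; lia.
- apply: (back `|(v - j)%R|%N u); [lia|lia|].
  have -> : j + (`|(v - j)%R|%N)%:Z = v by lia.
  exact: agree_sym.
- apply: (back `|(u - j)%R|%N v); [lia|lia|].
  by have -> : j + (`|(u - j)%R|%N)%:Z = u by lia.
- apply: (HN n ltac:(lia) (v - u) ltac:(lia) u).
  by have -> : u + (v - u) = v by lia.
Qed.

(** If beyond [N] the vertex [l] were always entered by the same edge, then each
    vertex would determine the past down to [N].  A repetition far to the right
    would be carried back to [N], at a bounded distance and with any length. *)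
Lemma left_extension_recurs n N : (n0 <= n)%N ->
  exists t, [/\ N <= t, agree x t m' n & x (t - 1) <> x (m' - 1)].
Proof.
move=> le; apply: contrapT => K.
have det t t' : N <= t -> N <= t' -> agree x t t' n -> x (t - 1) = x (t' - 1).
  move=> Nt Nt' H; apply: contrapT => ne.
  have H1 : agree x t m' n.
    by apply: agree_sym; apply: uLS => //; exists t'.
  have H2 : agree x t' m' n by apply: agree_trans (agree_sym H) H1.
  have [e1|ne1] := EM (x (t - 1) = x (m' - 1)); last by apply: K; exists t.
  have [e2|ne2] := EM (x (t' - 1) = x (m' - 1)); last by apply: K; exists t'.
  by apply: ne; rewrite e1 e2.
have [M HM] := no_repeat_right N (N + (complexity x n)%:Z) apr.
have [a [b [h1 h2 h3 ab]]] :=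
  @repeat_in_range _ x n (N + M%:Z) (complexity x n).+1 (ltnSn _).
have B (f : nat) : f%:Z <= a - N -> agree x (a - f%:Z) (b - f%:Z) (n + f).
  elim: f => [|f IH] fP; first by rewrite !subr0 addn0.
  have {IH} := IH ltac:(lia) => IH.
  have e : x (a - f%:Z - 1) = x (b - f%:Z - 1).
    by apply: det; [lia|lia|apply: (agree_sub IH); lia].
  by apply: (agree_sub (agree_pred IH e)); lia.
apply: (HM M (leqnn _) N (N + (b - a))); try lia.
by apply: (agree_sub (B `|(a - N)%R|%N ltac:(lia))); lia.
Qed.

(** Call [S] the set of edges used from [m - n] to [m' - 1].  It contains both
    edges that leave [r], and the walk meets [l] before the second of them.  So
    every edge that can follow an edge of [S] is in [S], and [S] contains all
    edges used after [m - n].  By recurrence it contains both edges that enter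
    [l], and then it is closed backwards as well. *)
Lemma both_extensions_occurs_in n t : (n0 <= n)%N -> m - n%:Z < t < m' ->
  agree x (m - n%:Z) t n -> x m <> x (t + n%:Z) ->
  occurs_in x n.+1 (m - n%:Z) (m' - 1).
Proof.
move=> le tP rt ne.
pose S i := exists j, m - n%:Z <= j <= m' - 1 /\ agree x i j n.+1.
have [|s [sP ls]] := left_special_between apl _ rt; first by lia.
have sl : agree x m' s n by apply: uLS.
have Sr i : agree x (m - n%:Z) i n -> S i.
  move=> ri; have := two_extensions (cS le) ri rt; rewrite subrK => -[e|//|e].
    exists (m - n%:Z); split; first by lia.
    by apply: agreeS; [exact: agree_sym|rewrite subrK].
  exists t; split; first by lia.
  by apply: agreeS => //; apply: agree_trans (agree_sym ri) rt.
have Snext i : S i -> S (i + 1).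
  move=> [j [jP ij]].
  have [j' [jP' ij']] : exists j', m - n%:Z <= j' <= m' - 1 /\
      agree x (i + 1) j' n.
    have H : agree x (i + 1) (j + 1) n by apply: (agree_sub ij); lia.
    have [lt|e] : j + 1 <= m' - 1 \/ j + 1 = m' by lia.
      by exists (j + 1); split=> //; lia.
    by exists s; split; [lia|apply: agree_trans H _; rewrite e].
  have [e|ne'] := EM (x (i + 1 + n%:Z) = x (j' + n%:Z)).
    by exists j'; split=> //; apply: agreeS.
  by apply: Sr; apply: uRS => //; exists j'.
have Sfut i : m - n%:Z <= i -> S i.
  move=> iP; have -> : i = m - n%:Z + (`|(i - (m - n%:Z))%R|%N)%:Z by lia.
  elim: `|_|%N => [|d IH].
    by exists (m - n%:Z); split; [lia|rewrite addr0; exact: agree_refl].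
  by have := Snext _ IH; rewrite -addrA -[_ + 1]/(d%:Z + 1%:Z) -PoszD addn1.
have [t' [t'P t'l net']] := left_extension_recurs (m - n%:Z + 1) le.
have Sl i : agree x m' (i + 1) n -> S i.
  move=> li; have ml j : S (j - 1) -> agree x j m' n -> x i = x (j - 1) -> S i.
    move=> [j' [j'P jj']] jm e; exists j'; split=> //.
    apply: agree_trans jj'.
    have := agree_pred (agree_trans jm li).
    by rewrite addrK => /(_ (esym e)); apply: agree_sym.
  have := two_left_extensions (cS le) li (agree_sym t'l).
  rewrite addrK => -[e|/esym //|e].
    by apply: (ml m') => //; apply: Sfut; lia.
  by apply: (ml t') => //; apply: Sfut; lia.
have Sprev i : S (i + 1) -> S i.
  move=> [j [jP ij]].
  have [j' [jP' ij']] : exists j', m - n%:Z < j' <= m' - 1 /\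
      agree x (i + 1) j' n.
    have [lt|e] : m - n%:Z < j \/ j = m - n%:Z by lia.
      by exists j; split; [lia|exact: agree_init].
    exists t; split; first by lia.
    by apply: agree_trans rt; rewrite -e; exact: agree_init.
  have [e|ne'] := EM (x (i + 1 - 1) = x (j' - 1)).
    exists (j' - 1); split; first by lia.
    by have := agree_pred ij' e; rewrite addrK.
  by apply: Sl; apply: uLS => //; exists j'.
move=> i; have [lt|ge] : m - n%:Z <= i \/ i < m - n%:Z by lia.
  exact: Sfut.
have -> : i = m - n%:Z - (`|(i - (m - n%:Z))%R|%N)%:Z by lia.
elim: `|_|%N => [|d IH]; first by apply: Sfut; lia.
apply: Sprev; have -> // : m - n%:Z - d.+1%:Z + 1 = m - n%:Z - d%:Z by lia.
Qed.

(** Let [t] be a second visit of [r], and [L] the length of the common word at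
    [m - n] and [t] up to where they differ.  Then the right special word of
    length [L] occurs at both places, followed by two different letters. *)
Lemma occurs_in_infinitely_often N : exists L, (N <= L)%N /\
  occurs_in x L.+1 (m - L%:Z) (m' - 1).
Proof.
have [N1 HN1] := right_special_interior.
pose n := maxn N (maxn n0 N1).
have [t [tP rt]] := HN1 n ltac:(lia).
have [|L [nL HL neL]] := first_break apr _ rt; first by lia.
exists L; split; first by lia.
have rL : agree x (m - L%:Z) (m - n%:Z) L.
  by apply: uRS; [lia|exists t].
have core t' : m - n%:Z <= t' < m' -> agree x (m - L%:Z) t' L ->
    x m <> x (t' + L%:Z) -> occurs_in x L.+1 (m - L%:Z) (m' - 1).
  move=> t'P rt' ne'; apply: (both_extensions_occurs_in _ _ rt') => //.
    by lia.
  have [//|e] : m - L%:Z < t' < m' \/ t' = m - L%:Z by lia.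
  by case: ne'; rewrite e subrK.
have [e|ne] := EM (x m = x (m - n%:Z + L%:Z)).
  apply: (core t); first by lia.
    exact: agree_trans rL HL.
  by rewrite e.
by apply: (core (m - n%:Z)) => //; lia.
Qed.

Lemma characteristic_covers : covers x m (m' - 1).
Proof. by apply: covers_of_long => // N; apply: occurs_in_infinitely_often. Qed.

(** Suppose that the span [m' - 1 - m] exceeds [k] by [D].  Then long words
    repeat, and a repetition extended as far as possible on both sides is a
    word of some length [h] that is special on both sides, visited at
    [m - h < i' < j' < m'].  Two of the first three visits leave by the same
    edge, so from both of them the walk is the same for some [g] steps, up to
    another visit.  This makes [g] edges superfluous, whence [g <= D] and a
    period bounded by [D] in long words. *)
Lemma characteristic_complexity n :
  (n0 <= n)%N -> (complexity x n)%:Z = n%:Z + (m' - 1 - m).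
Proof.
move=> le0; rewrite cxE //.
have le : k%:Z <= m' - 1 - m.
  have := occurs_in_complexity (characteristic_covers (n := n0.+1) isT).
  by rewrite cxE; lia.
have [//|lt] : k%:Z = m' - 1 - m \/ k%:Z < m' - 1 - m by lia.
  by move=> e; lia.
exfalso; pose D := `|(m' - 1 - m - k%:Z)%R|%N.
have [N HN] := no_short_period D.
pose n1 := maxn N n0.
have [|i [j [h1 h2 h3 ij]]] :=
    @repeat_in_range _ x n1 (m - n1%:Z + 1) `|(n1%:Z + (m' - 1 - m))%R|%N.
  by rewrite cxE; lia.
have [L [nL HL neL]] := first_break apr h2 ij.
have [f [Hf nef]] := first_break_left apl h2 HL.
pose h := (L + f)%N; pose i' := i - f%:Z; pose j' := j - f%:Z.
have h0 : (n0 <= h)%N by lia.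
have ri : agree x (m - h%:Z) i' h.
  apply: uRS => //; exists j'; split=> // e; apply: neL.
  have -> : i + L%:Z = i' + h%:Z by lia.
  by rewrite e; congr (x _); lia.
have rj : agree x (m - h%:Z) j' h by apply: agree_trans ri Hf.
have rl : agree x (m - h%:Z) m' h.
  by apply: agree_trans ri _; apply: agree_sym; apply: uLS => //; exists j'.
have core u v : m - h%:Z <= u -> u < v -> v < m' ->
    agree x (m - h%:Z) u h -> agree x (m - h%:Z) v h ->
    x (u + h%:Z) = x (v + h%:Z) -> False.
  move=> u1 uv v1 ru rv e.
  have uv1 : agree x u v h.+1.
    by apply: agreeS => //; apply: agree_trans (agree_sym ru) rv.
  have [G [hG HG neG]] := first_break apr uv uv1.
  have occ : occurs_in x h.+1 (m - h%:Z) (m' - 1).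
    have := characteristic_covers (n := h.+1) isT.
    by have -> : m - h.+1%:Z + 1 = m - h%:Z by lia.
  have short (g : nat) : (1 <= g)%N -> (h + g <= G)%N -> v + g%:Z <= m' ->
      ~ agree x (m - h%:Z) (u + g%:Z) h.
    move=> g1 gG vg rg.
    have := @occurs_in_repeat _ x h.+1 (g - 1)%N _ _ u v occ.
    have -> : (h.+1 + (g - 1) = h + g)%N by lia.
    move=> rep; have := rep _ u1 uv ltac:(lia).
    rewrite cxE; last by lia.
    move=> {}rep; have {}rep := rep ltac:(by apply: (agree_sub HG); lia).
    apply: (HN h ltac:(lia) g%:Z ltac:(lia) u).
    exact: agree_trans (agree_sym ru) rg.
  have [lev|gtv] : v + (G - h)%N%:Z <= m' \/ m' - v < (G - h)%N%:Z by lia.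
    apply: (short (G - h)%N) => //; try lia.
    apply: uRS => //; apply: (@right_special_suffix _ x u G); try lia.
    by exists v.
  apply: (short `|(m' - v)%R|%N); try lia.
  apply: agree_trans rl _; apply: agree_sym.
  by apply: (agree_sub HG); lia.
have h4 : m - h%:Z < i' by lia.
have h5 : i' < j' by lia.
have h6 : j' < m' by lia.
have [e|e|e] := two_extensions (cS h0) ri rj.
- apply: (core _ _ (lexx _) h4 (lt_trans h5 h6) _ ri e); exact: agree_refl.
- by apply: (core _ _ (lexx _) (lt_trans h4 h5) h6 _ rj e); exact: agree_refl.
- exact: (core i' j' (ltW h4) h5 h6 ri rj e).
Qed.

End Characteristic.

(** * Purely periodic and eventually periodic words *)

Definition right_period (A : Type) (x : int -> A) (p : nat) : Prop :=
  (1 <= p)%N /\ exists N : int, forall t, N < t -> x t = x (t + p%:Z).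

Definition left_period (A : Type) (x : int -> A) (q : nat) : Prop :=
  (1 <= q)%N /\ exists N : int, forall t, t < N -> x t = x (t - q%:Z).

Lemma residue (p : nat) (lo t : int) : (1 <= p)%N ->
  exists z : int, lo <= t + z * p%:Z < lo + p%:Z.
Proof.
move=> p1; exists (- ((t - lo) %/ p%:Z)%Z); rewrite mulNr.
have e := divz_eq (t - lo) p%:Z.
have := modz_ge0 (t - lo) (d := p%:Z) ltac:(lia).
have := ltz_pmod (t - lo) (d := p%:Z) ltac:(lia).
lia.
Qed.

Lemma right_congr (A : Type) (x : int -> A) (p : nat) (N t z : int) :
  (forall t, N < t -> x t = x (t + p%:Z)) ->
  N < t -> N < t + z * p%:Z -> x t = x (t + z * p%:Z).
Proof.
move=> H.
have up (c : nat) s : N < s -> x s = x (s + c%:Z * p%:Z).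
  elim: c s => [|c IH] s Ns; first by rewrite mul0r addr0.
  rewrite H // IH; last by lia.
  by congr (x _); lia.
move=> Nt Nz; have [z0|z0] : 0 <= z \/ z < 0 by lia.
  by have := up `|z|%N t Nt; have -> : (`|z|%N)%:Z = z by lia.
rewrite [RHS](up `|z|%N) //; congr (x _).
have -> : (`|z|%N)%:Z = - z by lia.
by rewrite mulNr addrK.
Qed.

Lemma left_congr (A : Type) (x : int -> A) (q : nat) (N t z : int) :
  (forall t, t < N -> x t = x (t - q%:Z)) ->
  t < N -> t + z * q%:Z < N -> x t = x (t + z * q%:Z).
Proof.
move=> H tN zN; have := @right_congr _ (mirror x) q (- N) (- t) (- z).
rewrite /mirror opprK mulNr -opprD opprK; apply; [|lia|lia].
by move=> s sN; rewrite H; [congr (x _); lia|lia].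
Qed.

Lemma minimal_witness (P : nat -> Prop) :
  (exists n, P n) -> exists n, P n /\ forall m, P m -> (n <= m)%N.
Proof.
move=> [n Pn]; have ex : exists n, `[< P n >] by exists n; apply/asboolP.
case: (ex_minnP ex) => m /asboolP Pm minm; exists m; split=> // l Pl.
by apply: minm; apply/asboolP.
Qed.

Section Periodic.
Variables (A : finType) (x : int -> A).

Lemma periodic_agree p n (i j z : int) : has_period x p -> j = i + z * p%:Z ->
  agree x i j n.
Proof.
move=> [p1 per] ->; apply: agree_intro => t tP.
rewrite (@right_congr _ x p (- `|t|%R - `|z|%R * p%:Z - 1) t z) //; try lia.
by congr (x _); lia.
Qed.

Lemma periodic_occurs_in p n lo : has_period x p ->
  occurs_in x n lo (lo + p%:Z - 1).
Proof.
move=> per i; have [z zP] := residue lo i per.1.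
exists (i + z * p%:Z); split; first by lia.
exact: periodic_agree per erefl.
Qed.

Lemma minimal_period_complexity p n :
  minimal_period x p -> (p <= n)%N -> complexity x n = p.
Proof.
move=> [per minp] pn; apply/eqP; rewrite eqn_leq; apply/andP; split.
  by have := occurs_in_complexity (periodic_occurs_in n 0 per); lia.
rewrite leqNgt; apply/negP => lt.
have [i [j [i0 ij jp H]]] := @repeat_in_range _ x n 0 p lt.
suff : (p <= `|(j - i)%R|)%N by lia.
apply: minp; split; first by lia.
move=> t; have [z zP] := residue i t per.1.
have e := @periodic_agree p (`|(j - i)%R|).+1 t (t + z * p%:Z) z per erefl.
rewrite (agree_at e (u := t + z * p%:Z)); try lia.
rewrite [RHS](agree_at e (u := t + z * p%:Z + (j - i))); try lia.
by apply: (agree_at H); lia.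
Qed.

Lemma periodic_covers p : has_period x p -> covers x 0 (p%:Z - 1).
Proof.
move=> per n n1 i; have [j [jP ij]] := periodic_occurs_in n 0 per i.
by exists j; split=> //; lia.
Qed.

End Periodic.

Section EventuallyPeriodic.
Variables (A : finType) (x : int -> A) (p q : nat) (b0 b1 : int).
Let P : int := p%:Z * q%:Z.
Hypotheses (p1 : (1 <= p)%N) (q1 : (1 <= q)%N).
Hypothesis rper : forall t, b1 < t -> x t = x (t + p%:Z).
Hypothesis lper : forall t, t < b0 + P -> x t = x (t - q%:Z).
Hypothesis minp : forall d, right_period x d -> (p <= d)%N.
Hypothesis minq : forall d, left_period x d -> (q <= d)%N.
Hypotheses (break0 : x b0 <> x (b0 + P)) (break1 : x b1 <> x (b1 + P)).

(* [P] is a common period of both tails, and [b0] and [b1] are the first and the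
   last positions where this period fails.  Thus the left tail extends up to
   [b0 + P - 1] and the right tail starts at [b1 + 1]. *)

Let P1 : 1 <= P. Proof. by rewrite /P; nia. Qed.

Let after_break t : b1 < t -> x t = x (t + P).
Proof.
by move=> tb; rewrite /P mulrC; apply: (right_congr rper) => //; nia.
Qed.

Let before_break t : t < b0 -> x t = x (t + P).
Proof. by move=> tb; apply: (left_congr lper); rewrite -/P; lia. Qed.

Let rcongr t z : b1 < t -> b1 < t + z * p%:Z -> x t = x (t + z * p%:Z).
Proof. exact: right_congr. Qed.

Let lcongr t z : t < b0 + P -> t + z * q%:Z < b0 + P -> x t = x (t + z * q%:Z).
Proof. exact: left_congr. Qed.

(** Whether the two tails repeat the same word: a long word of a periodic tail
    contains all its factors. *)
Definition tails_match := forall n : nat, exists i j,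
  [/\ i + n%:Z <= b0 + P, b1 < j & agree x i j n].

(** If the tails match, the words of the left tail are found in the right tail;
    otherwise the attractor needs a full period [q] of the left tail. *)
Definition left_end := if `[< tails_match >] then b0 + P else b0 + P - q%:Z.

Let a := left_end.

Let a_match : tails_match -> a = b0 + P.
Proof. by move=> H; rewrite /a /left_end; case: asboolP. Qed.

Let a_mismatch : ~ tails_match -> a = b0 + P - q%:Z.
Proof. by move=> H; rewrite /a /left_end; case: asboolP. Qed.

Let a_bounds : b0 + P - q%:Z <= a <= b0 + P.
Proof. by rewrite /a /left_end; case: asboolP => _; lia. Qed.

(** The window that ends before [left_end] lies in the left tail, and so does
    its shift by one period [q], to the left or to the right.  One of the two
    is followed by the letter at [b0 + P], which breaks the period. *)
Lemma left_end_right_special n : right_special_at x (a - n%:Z) n.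
Proof.
have x0 : x b0 = x (b0 + P - q%:Z).
  rewrite (@lcongr b0 (p%:Z - 1)); try (rewrite /P; lia).
  by congr (x _); rewrite /P; lia.
have [H|H] := EM tails_match.
  rewrite (a_match H); exists (b0 + P - n%:Z - q%:Z); split.
    apply: agree_intro => t tP; rewrite lper; last by lia.
    by congr (x _); lia.
  rewrite subrK => e; apply: break0; rewrite x0 e.
  by congr (x _); lia.
rewrite (a_mismatch H); exists (b0 + P - n%:Z); split.
  apply: agree_intro => t tP; rewrite [RHS]lper; last by lia.
  by congr (x _); lia.
by rewrite !subrK -x0.
Qed.

Let right_rep n i : b1 < i -> exists j, b1 < j <= b1 + p%:Z /\ agree x i j n.
Proof.
move=> ib; have [z zP] := residue (b1 + 1) i p1; exists (i + z * p%:Z).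
split; first by lia.
apply: agree_intro => t tP; rewrite (@rcongr t z); try lia.
by congr (x _); lia.
Qed.

(** Long windows meet the interval, unless they lie in a tail, where they can be
    moved by multiples of the period. *)
Lemma long_occurs_in : exists n1, forall n, (n1 <= n)%N ->
  occurs_in x n (a - n%:Z + 1) (b1 + p%:Z).
Proof.
exists (`|(b0 + P - b1)%R| + q)%N => n le i.
have Hr k : b1 < k -> exists j,
    a - n%:Z + 1 <= j <= b1 + p%:Z /\ agree x k j n.
  by move=> /(right_rep n)[j [jP kj]]; exists j; split=> //; lia.
have [ib|ib] : b1 < i \/ i <= b1 by lia.
  exact: Hr.
have [ia|ia] : a - n%:Z + 1 <= i \/ i + n%:Z <= a by lia.
  by exists i; split; [lia|exact: agree_refl].
have [H|H] := EM tails_match; last first.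
  have [z zP] := residue (a - n%:Z + 1) i q1; exists (i + z * q%:Z).
  have e := a_mismatch H; split; first by lia.
  apply: agree_intro => t tP; rewrite (@lcongr t z); try lia.
  by congr (x _); lia.
have e := a_match H; have [u [v [uP vP uv]]] := H (n + q)%N.
have [z zP] := residue u i q1.
have [|j [jP jH]] := Hr (i + z * q%:Z - u + v); first by lia.
exists j; split=> //; apply: agree_trans jH.
apply: (@agree_trans _ _ (i + z * q%:Z)).
  apply: agree_intro => t tP; rewrite (@lcongr t z); try lia.
  by congr (x _); lia.
by apply: (agree_sub uv); lia.
Qed.

Lemma eventually_periodic_covers : covers x a (b1 + p%:Z).
Proof.
apply: covers_of_long; first exact: left_end_right_special.
move=> N; have [n1 H] := long_occurs_in; exists (maxn N n1); split; first by lia.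
have := H (maxn N n1).+1 ltac:(lia).
by have -> : a - (maxn N n1).+1%:Z + 1 = a - (maxn N n1)%:Z by lia.
Qed.

(** Equal windows show the same failures of the period [P].  Suppose that the
    windows at [i < j] are equal and long.  The window at [i] does not show the
    last failure [b1], whose copy would be a later one; likewise the window at
    [j] does not show [b0].  So each of them lies in a tail, apart from a
    bounded part, and the minimality of [p] and of [q], or the mismatch of the
    tails, excludes the remaining cases. *)
Lemma long_distinct : exists n1, forall n, (n1 <= n)%N -> forall i j,
  a - n%:Z + 1 <= i -> i < j -> j <= b1 + p%:Z -> ~ agree x i j n.
Proof.
have [n2 Hn2] : exists n2, ~ tails_match -> forall n, (n2 <= n)%N ->
    forall i j, i + n%:Z <= b0 + P -> b1 < j -> ~ agree x i j n.
  have [H|H] := EM tails_match; first by exists 0%N.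
  have [n2 Hn2] : exists n2 : nat, forall i j, i + n2%:Z <= b0 + P ->
      b1 < j -> ~ agree x i j n2.
    apply: contrapT => K; apply: H => n; apply: contrapT => L.
    by apply: K; exists n => i j h1 h2 h3; apply: L; exists i, j.
  exists n2 => _ n le i j h1 h2 h3; apply: (Hn2 i j) => //; first by lia.
  by apply: (agree_sub h3); lia.
pose w := `|(b1 - b0)%R|%N.
exists (n2 + `|P| + w + w + p + q + 2)%N => n le i j ia ij jb H.
have H1 : ~ (i <= b1 <= i + (n%:Z - P) - 1).
  move=> bP; apply: break1.
  rewrite (agree_at H (u := b1 + (j - i))); try lia.
  rewrite after_break; last by lia.
  rewrite [RHS](agree_at H (u := b1 + (j - i) + P)); try lia.
  by [].
have H0 : ~ (j <= b0 <= j + (n%:Z - P) - 1).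
  move=> bP; apply: break0; have H' := agree_sym H.
  rewrite (agree_at H' (u := b0 - (j - i))); try lia.
  rewrite before_break; last by lia.
  rewrite [RHS](agree_at H' (u := b0 - (j - i) + P)); try lia.
  by [].
have [ib|ib] : b1 < i \/ i + (n%:Z - P) - 1 < b1 by lia.
  suff : (p <= `|(j - i)%R|)%N by lia.
  apply: minp; split; first by lia.
  exists i => t ti; have [z zP] := residue i t p1.
  rewrite (@rcongr t z); try lia.
  have -> : t + (`|(j - i)%R|%N)%:Z = t + (j - i) by lia.
  rewrite [RHS](@rcongr _ z); try lia.
  by apply: (agree_at H); lia.
(* If the window at [i] shows [b0], then it shows it near its end, and the copy
   falls after [b1]. *)
have inner : b0 <= i + (n%:Z - P) - 1 -> False.
  move=> bP; apply: break0.
  rewrite (agree_at H (u := b0 + (j - i))); try lia.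
  rewrite after_break; last by lia.
  rewrite [RHS](agree_at H (u := b0 + (j - i) + P)); try lia.
  by [].
have [H2|nm] := EM tails_match.
  by have e := a_match H2; apply: inner; lia.
have e := a_mismatch nm.
have [le0|ib0] : b0 <= i + (n%:Z - P) - 1 \/ i + (n%:Z - P) - 1 < b0 by lia.
  exact: inner.
have [jb0|jb0] : b0 < j \/ j + (n%:Z - P) - 1 < b0 by lia.
  have [jb1|jb1] : b1 < j \/ j <= b1 by lia.
    by apply: (Hn2 nm n ltac:(lia) i j) => //; lia.
  apply: break1; have H' := agree_sym H.
  rewrite (agree_at H' (u := b1 - (j - i))); try lia.
  rewrite before_break; last by lia.
  rewrite [RHS](agree_at H' (u := b1 - (j - i) + P)); try lia.
  by [].
suff : (q <= `|(j - i)%R|)%N by lia.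
apply: minq; split; first by lia.
exists (j + n%:Z) => t tj; have [z zP] := residue (j + n%:Z - q%:Z) t q1.
rewrite (@lcongr t z); try lia.
have -> : t - (`|(j - i)%R|%N)%:Z = t - (j - i) by lia.
rewrite [RHS](@lcongr _ z); try lia.
by apply: (agree_at (agree_sym H)); lia.
Qed.

Lemma eventually_periodic_complexity : exists n1, forall n, (n1 <= n)%N ->
  (complexity x n)%:Z = n%:Z + (b1 + p%:Z - a).
Proof.
have [n1 Hn1] := long_distinct.
exists (maxn 1 (maxn n1 `|(b1 + p%:Z - a)%R|))%N => n le.
have h := occurs_in_complexity (eventually_periodic_covers (n := n) ltac:(lia)).
have [lt|ge] : (complexity x n < `|(n%:Z + (b1 + p%:Z - a))%R| \/
    `|(n%:Z + (b1 + p%:Z - a))%R| <= complexity x n)%N by lia.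
  have [i [j [h1 h2 h3 H]]] := @repeat_in_range _ x n (a - n%:Z + 1) _ lt.
  by case: (Hn1 n ltac:(lia) i j) => //; lia.
by lia.
Qed.

End EventuallyPeriodic.

(** Beyond the last failure of the multiple [c * p], the period [p] itself
    holds: move both letters far to the right by multiples of [c * p]. *)
Lemma last_break (A : finType) (x : int -> A) (p c : nat) (t0 : int) :
  right_period x p -> (1 <= c)%N -> x t0 <> x (t0 + (c * p)%N%:Z) ->
  exists b, x b <> x (b + (c * p)%N%:Z) /\ forall t, b < t -> x t = x (t + p%:Z).
Proof.
move=> [p1 [N per]] c1 ne; set P := (c * p)%N.
have big t : N < t -> x t = x (t + P%:Z).
  move=> Nt; have := right_congr (z := c%:Z) per Nt.
  have -> : c%:Z * p%:Z = P%:Z by lia.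
  by apply; lia.
pose Q (n : nat) := forall s, t0 + n%:Z < s -> x s = x (s + P%:Z).
have [|n [nQ minn]] := @minimal_witness Q.
  by exists `|(N - t0)%R|%N => s sP; apply: big; lia.
exists (t0 + n%:Z); split.
  case: n nQ minn => [|n] nQ minn; first by rewrite addr0.
  move=> e; have : (n.+1 <= n)%N; last by lia.
  apply: minn => s sP; have [->|gt] : s = t0 + n.+1%:Z \/ t0 + n.+1%:Z < s by lia.
    exact: e.
  exact: nQ.
move=> t tP; pose z : int := (`|(N - t)%R|%N.+1)%:Z.
have P1 : 1 <= P%:Z by lia.
have zP : z <= z * P%:Z by nia.
have congrP s : t <= s -> x s = x (s + z * P%:Z).
  by move=> ts; apply: (right_congr nQ); lia.
rewrite congrP // per; last by lia.
rewrite [RHS]congrP; last by lia.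
by congr (x _); lia.
Qed.

Lemma left_period_mirror (A : Type) (x : int -> A) q :
  left_period x q -> right_period (mirror x) q.
Proof.
move=> [q1 [N per]]; split=> //; exists (- N) => t tN.
by rewrite /mirror per; [congr (x _); lia|lia].
Qed.

Lemma eventually_periodic_interval (A : finType) (x : int -> A) :
  eventually_periodic x -> ~ purely_periodic x -> exists (a b : int) (n1 : nat),
    covers x a b /\
    forall n, (n1 <= n)%N -> (complexity x n)%:Z = n%:Z + (b - a).
Proof.
move=> [p0 [q0 [Np [Nq [p01 q01 hp hq]]]]] np.
have [|p [rp minp]] := @minimal_witness (right_period x).
  by exists p0; split=> //; exists Np => t tN; apply: hp; lia.
have [|q [lq minq]] := @minimal_witness (left_period x).
  by exists q0; split=> //; exists Nq => t tN; apply: hq; lia.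
have p1 := rp.1; have q1 := lq.1.
have [t0 ne] : exists t0, x t0 <> x (t0 + (q * p)%N%:Z).
  apply: contrapT => K; apply: np; exists (q * p)%N; split; first by nia.
  by move=> t; apply: contrapT => ne; apply: K; exists t.
have [b1 [ne1 per1]] := last_break rp q1 ne.
have [|b [neb perb]] := @last_break _ (mirror x) q p (- t0 - (q * p)%N%:Z)
    (left_period_mirror lq) p1.
  rewrite /mirror => e; apply: ne.
  have -> : t0 + (q * p)%N%:Z = - (- t0 - (q * p)%N%:Z) by lia.
  by rewrite [RHS]e; congr (x _); lia.
pose P : int := p%:Z * q%:Z; pose b0 := - b - P.
have PE : P = (q * p)%N%:Z by rewrite /P; lia.
have lper t : t < b0 + P -> x t = x (t - q%:Z).
  move=> tP; have := perb (- t) ltac:(lia); rewrite /mirror opprK => ->.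
  by congr (x _); lia.
have ne0 : x b0 <> x (b0 + P).
  move=> e; apply: neb; rewrite /mirror.
  have -> : - b = b0 + P by rewrite /b0; lia.
  by rewrite -e; congr (x _); rewrite /b0 /P; lia.
rewrite -PE in ne1.
have [n1 Hn1] := eventually_periodic_complexity p1 q1 per1 lper minp minq ne0 ne1.
exists (left_end x p q b0 b1), (b1 + p%:Z), n1; split=> //.
exact: eventually_periodic_covers.
Qed.

(** * Spans in the extended integers *)

Lemma supremumE (x0 v : \bar int) (S : set (\bar int)) :
  S !=set0 -> supremums S v -> supremum x0 S = v.
Proof.
move=> /set0P S0 Sv; rewrite /supremum (negPf S0).
by apply: is_subset1_supremums (Sv); apply: xgetPex; exists v.
Qed.

Lemma infimumE (x0 v : \bar int) (S : set (\bar int)) :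
  S !=set0 -> infimums S v -> infimum x0 S = v.
Proof.
move=> /set0P S0 Sv; rewrite /infimum (negPf S0).
by apply: is_subset1_infimums (Sv); apply: xgetPex; exists v.
Qed.

Section Span.
Implicit Types (G : set int) (a b : int).

Lemma supremum_max G b : G b -> (forall g, G g -> g <= b) ->
  supremum -oo%E (EFin @` G) = b%:E.
Proof.
move=> Gb le; apply: supremumE; first by exists b%:E, b.
split; first by move=> _ [g Gg <-]; rewrite lee_fin; apply: le.
by move=> y; apply; exists b.
Qed.

Lemma infimum_min G a : G a -> (forall g, G g -> a <= g) ->
  infimum +oo%E (EFin @` G) = a%:E.
Proof.
move=> Ga le; apply: infimumE; first by exists a%:E, a.
split; first by move=> _ [g Gg <-]; rewrite lee_fin; apply: le.
by move=> y; apply; exists a.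
Qed.

Lemma supremum_unbounded G : (forall b, exists2 g, G g & b < g) ->
  supremum -oo%E (EFin @` G) = +oo%E.
Proof.
move=> H; apply: supremumE; first by have [g Gg _] := H 0; exists g%:E, g.
split; first by move=> _ [g Gg <-]; exact: leey.
move=> [b|//|] ub.
  have [g Gg lt] := H b; have := ub g%:E ltac:(by exists g).
  by rewrite lee_fin; lia.
have [g Gg _] := H 0; have := ub g%:E ltac:(by exists g).
by [].
Qed.

Lemma infimum_unbounded G : (forall a, exists2 g, G g & g < a) ->
  infimum +oo%E (EFin @` G) = -oo%E.
Proof.
move=> H; apply: infimumE; first by have [g Gg _] := H 0; exists g%:E, g.
split; first by move=> _ [g Gg <-]; exact: leNye.
move=> [b||//] ub.
  have [g Gg lt] := H b; have := ub g%:E ltac:(by exists g).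
  by rewrite lee_fin; lia.
have [g Gg _] := H 0; have := ub g%:E ltac:(by exists g).
by [].
Qed.

(** Together with [supremum_max] and [supremum_unbounded], this computes the
    supremum of any nonempty set of integers. *)
Lemma max_or_unbounded G : G !=set0 ->
  (exists2 b, G b & forall g, G g -> g <= b) \/ (forall b, exists2 g, G g & b < g).
Proof.
move=> [g0 Gg0]; have [H|H] := EM (forall b, exists2 g, G g & b < g).
  by right.
left; have [b Hb] : exists b, forall g, G g -> g <= b.
  apply: contrapT => K; apply: H => b; apply: contrapT => L; apply: K.
  exists b => g Gg; rewrite leNgt; apply/negP => lt; apply: L.
  by exists g.
have [|n [nP minn]] :=
    @minimal_witness (fun n => forall g, G g -> g <= g0 + n%:Z).
  by exists `|(b - g0)%R|%N => g Gg; have := Hb g Gg; lia.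
exists (g0 + n%:Z) => //; case: n nP minn => [|n] nP minn.
  by rewrite addr0.
apply: contrapT => nG; suff : (n.+1 <= n)%N by lia.
apply: minn => g Gg; have := nP g Gg.
have [e|ne] : g = g0 + n.+1%:Z \/ g <> g0 + n.+1%:Z by lia.
  by case: nG; rewrite -e.
by lia.
Qed.

Lemma min_or_unbounded G : G !=set0 ->
  (exists2 a, G a & forall g, G g -> a <= g) \/ (forall a, exists2 g, G g & g < a).
Proof.
move=> [g0 Gg0]; have [|[b Gb Hb]|H] := @max_or_unbounded [set - g | g in G].
- by exists (- g0), g0.
- left; case: Gb => g Gg gb; exists g => // g' Gg'.
  by have := Hb (- g') ltac:(by exists g'); lia.
- right=> a; have [_ [g Gg <-] lt] := H (- a); exists g => //; lia.
Qed.

Lemma set_span_interval a b : a <= b -> set_span [set` `[a, b]] = (b - a)%:E.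
Proof.
move=> ab; rewrite /set_span (@supremum_max _ b) ?(@infimum_min _ a) //=;
  rewrite ?in_itv /=; try lia.
- by move=> g; rewrite in_itv /=; lia.
- by move=> g; rewrite in_itv /=; lia.
Qed.

Lemma set_span_cases G : G !=set0 -> set_span G = +oo%E \/ exists a b,
  [/\ forall g, G g -> a <= g <= b, a <= b & set_span G = (b - a)%:E].
Proof.
move=> G0; rewrite /set_span.
have [[b Gb Hb]|Hb] := max_or_unbounded G0; last first.
  left; rewrite supremum_unbounded //.
  have [[a Ga Ha]|Ha] := min_or_unbounded G0; first by rewrite (infimum_min Ga).
  by rewrite infimum_unbounded.
rewrite (supremum_max Gb) //.
have [[a Ga Ha]|Ha] := min_or_unbounded G0; last first.
  by left; rewrite infimum_unbounded.
right; exists a, b; rewrite (infimum_min Ga) //; split=> //; last exact: Hb.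
by move=> g Gg; rewrite Ha // Hb.
Qed.

End Span.

Lemma finite_set_bounded (G : set int) : finite_set G ->
  exists a b, forall g, G g -> a <= g <= b.
Proof.
move=> /finite_seqP[s ->]; elim: s => [|y s [a [b H]]]; first by exists 0, 0.
exists (Order.min a y), (Order.max b y) => g /=; rewrite inE => /orP[/eqP->|gs].
  by lia.
by have := H g gs; lia.
Qed.

(** * Attractors as intervals, and their spans *)

Section Attractors.
Variables (A : finType) (x : int -> A).
Implicit Types (G : set int) (a b : int).

Lemma attractor_covers G a b : string_attractor x G ->
  (forall g, G g -> a <= g <= b) -> covers x a b.
Proof.
move=> att Gab n n1 i.
have [||j [jE [g [/= gP Gg]]]] := att (window x i n).
- by move=> /(congr1 size); rewrite size_mkseq /=; lia.
- by exists i; rewrite size_mkseq.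
move: jE gP; rewrite size_mkseq in_itv /= => jE gP.
have := Gab g Gg; exists j; split; first by lia.
by apply/agree_windowP.
Qed.

Lemma covers_le a b : covers x a b -> a <= b.
Proof. by move=> /(_ 1%N isT 0)[j [jP _]]; lia. Qed.

Lemma covers_attractor a b : covers x a b -> string_attractor x [set` `[a, b]].
Proof.
move=> cov w w0 [i wi]; have ab := covers_le cov.
have sw : (1 <= size w)%N by case: w w0 {wi}.
have [j [jP ij]] := cov _ sw i; exists j; split.
  by rewrite -[RHS]wi; apply/agree_windowP; exact: agree_sym.
by exists (Order.max a j); split; rewrite /= in_itv /=; lia.
Qed.

Lemma finite_attractorP : (exists G, finite_set G /\ string_attractor x G) <->
  exists a b, covers x a b.
Proof.
split=> [[G [/finite_set_bounded[a [b Gab]] att]]|[a [b cov]]].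
  by exists a, b; apply: attractor_covers att Gab.
exists [set` `[a, b]]; split; last exact: covers_attractor.
apply: (@sub_finite_set _ _ [set` irange a `|(b - a)%R|.+1]); last first.
  exact: finite_seq.
by move=> g /=; rewrite in_itv /= mem_irange; lia.
Qed.

(** The spans of attractors are [+oo] or spans of intervals, so their infimum is
    a minimum over the naturals. *)
Lemma word_span_min (n : nat) : (exists a, covers x a (a + n%:Z)) ->
  (forall m : nat, (exists a, covers x a (a + m%:Z)) -> (n <= m)%N) ->
  word_span x = n%:Z%:E.
Proof.
move=> [a cov] minn.
have attn : [set set_span G | G in string_attractor x] n%:Z%:E.
  exists [set` `[a, a + n%:Z]]; first exact: covers_attractor.
  by rewrite set_span_interval ?(addrC a) ?addrK //; lia.
apply: infimumE; first by exists n%:Z%:E.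
split; last by move=> y; apply.
move=> _ [G att <-].
have G0 : G !=set0.
  have [||j [_ [g [_ Gg]]]] := att (window x 0 1) => //; last by exists g.
  by exists 0; rewrite size_mkseq.
have [->|[a' [b' [Gab ab ->]]]] := set_span_cases G0; first exact: leey.
have := minn `|(b' - a')%R|%N; rewrite lee_fin => le.
suff : (n <= `|(b' - a')%R|)%N by lia.
apply: le; exists a'; have -> : a' + (`|(b' - a')%R|%N)%:Z = b' by lia.
exact: attractor_covers att Gab.
Qed.

Lemma word_span_le a b :
  covers x a b -> exists2 n : nat, n%:Z <= b - a & word_span x = n%:Z%:E.
Proof.
move=> cov; have ab := covers_le cov.
have cov' : covers x a (a + (`|(b - a)%R|%N)%:Z).
  by have -> : a + (`|(b - a)%R|%N)%:Z = b by lia.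
have [|n [Hn minn]] := @minimal_witness (fun n => exists a, covers x a (a + n%:Z)).
  by exists `|(b - a)%R|%N, a.
exists n; last exact: word_span_min.
by have := minn `|(b - a)%R|%N ltac:(by exists a); lia.
Qed.

(** An attractor of smaller span would bound the complexity too much. *)
Lemma word_span_complexity a b n1 : covers x a b ->
  (forall n, (n1 <= n)%N -> (complexity x n)%:Z = n%:Z + (b - a)) ->
  forall n, (n1 <= n)%N ->
    (complexity x n)%:Z%:E = (n%:Z%:E + word_span x)%E.
Proof.
move=> cov cE n le; have ab := covers_le cov.
rewrite (@word_span_min `|(b - a)%R|%N).
- by rewrite -EFinD cE //; congr EFin; lia.
- by exists a; have -> : a + (`|(b - a)%R|%N)%:Z = b by lia.
move=> m [a' cov'].
have := occurs_in_complexity (cov' (maxn 1 n1) ltac:(lia)).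
by rewrite cE; lia.
Qed.

(** The complexity minus [n] is nondecreasing and bounded by [b - a]; it is
    constant from where [f], its distance to this bound, is minimal. *)
Lemma complexity_eventually_affine a b : covers x a b -> ~ purely_periodic x ->
  exists n0 k : nat, (1 <= k)%N /\
    forall n, (n0 <= n)%N -> complexity x n = (n + k)%N.
Proof.
move=> cov np; pose f n := `|(n%:Z + (b - a) - (complexity x n)%:Z)%R|%N.
have fE n : (1 <= n)%N -> (complexity x n + f n)%:Z = n%:Z + (b - a).
  by move=> n1; have := occurs_in_complexity (cov n n1); rewrite /f; lia.
have [|d [[n0 [n01 fn0]] mind]] :=
    @minimal_witness (fun d => exists n, (1 <= n)%N /\ f n = d).
  by exists (f 1%N), 1%N.
have h0 := complexity_gt n0 np; have e0 := fE n0 n01.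
exists n0, (complexity x n0 - n0)%N; split; first by lia.
move=> n le; suff : (f n <= d)%N.
  have := mind (f n) ltac:(by exists n; split; lia).
  by have := fE n ltac:(lia); lia.
have -> : n = (n0 + (n - n0))%N by lia.
elim: (n - n0)%N => [|c IH]; first by rewrite addn0 fn0.
apply: leq_trans IH; have := complexity_lt (n0 + c) np; rewrite addnS.
by have := fE (n0 + c)%N ltac:(lia); have := fE (n0 + c).+1 ltac:(lia); lia.
Qed.

End Attractors.

(** * Characteristic words *)

Section Windows.
Variables (A : Type) (x : int -> A).
Implicit Types (i m : int) (n : nat).

Lemma size_window i n : size (window x i n) = n.
Proof. exact: size_mkseq. Qed.

Lemma window_rcons i n : window x i n.+1 = rcons (window x i n) (x (i + n%:Z)).
Proof. exact: mkseqS. Qed.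

Lemma window_cat i n n' :
  window x i (n + n') = window x i n ++ window x (i + n%:Z) n'.
Proof.
elim: n' => [|n' IH]; first by rewrite addn0 cats0.
by rewrite addnS !window_rcons IH rcons_cat PoszD addrA.
Qed.

Lemma window_cons i n : window x i n.+1 = x i :: window x (i + 1) n.
Proof. by rewrite -add1n window_cat /window /= addr0. Qed.

Lemma right_specialP i n :
  right_special x (window x i n) <-> right_special_at x i n.
Proof.
split=> [[_ [a [b [ab [j jE] [k kE]]]]]|[j [ij ne]]].
  move: jE kE; rewrite !size_rcons size_window !window_rcons.
  move=> /rcons_inj[/agree_windowP ji ja] /rcons_inj[/agree_windowP ki kb].
  apply: (right_special_agree ji); exists k; split; last by rewrite ja kb.
  by apply: agree_trans ji (agree_sym ki).
split; first by exists i; rewrite size_window.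
exists (x (i + n%:Z)), (x (j + n%:Z)); split=> //.
  by exists i; rewrite size_rcons size_window window_rcons.
exists j; rewrite size_rcons size_window window_rcons.
by congr rcons; apply/agree_windowP; exact: agree_sym.
Qed.

Lemma left_specialP i n :
  left_special x (window x i n) <-> left_special_at x i n.
Proof.
split=> [[_ [a [b [ab [j jE] [k kE]]]]]|[j [ij ne]]].
  move: jE kE; rewrite /= size_window !window_cons.
  move=> [ja /agree_windowP ji] [kb /agree_windowP ki].
  apply: (left_special_agree ji); exists (k + 1).
  split; last by rewrite !addrK ja kb.
  by apply: agree_trans ji (agree_sym ki).
split; first by exists i; rewrite size_window.
exists (x (i - 1)), (x (j - 1)); split=> //.
  by exists (i - 1); rewrite /= size_window window_cons subrK.
exists (j - 1); rewrite /= size_window window_cons subrK.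
by congr cons; apply/agree_windowP; exact: agree_sym.
Qed.

Lemma is_r_eq i n r : is_r x n r -> right_special_at x i n -> r = window x i n.
Proof.
move=> [_ uniq_r] rs; apply: uniq_r; rewrite size_window; split=> //.
exact/right_specialP.
Qed.

Lemma is_ell_eq i n l : is_ell x n l -> left_special_at x i n -> l = window x i n.
Proof.
move=> [_ uniq_l] ls; apply: uniq_l; rewrite size_window; split=> //.
exact/left_specialP.
Qed.

End Windows.

Section Unique.
Variables (A : finType) (x : int -> A) (n : nat).
Hypothesis cS : (complexity x n.+1 <= (complexity x n).+1)%N.

Lemma is_r_window i : right_special_at x i n -> is_r x n (window x i n).
Proof.
move=> rs; split=> [|u [su ru]].
  by rewrite size_window; split=> //; apply/right_specialP.
have [j jE] := ru.1; rewrite su in jE; rewrite -jE in ru *.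
by apply/agree_windowP; apply: right_special_unique => //; apply/right_specialP.
Qed.

Lemma is_ell_window i : left_special_at x i n -> is_ell x n (window x i n).
Proof.
move=> ls; split=> [|u [su lu]].
  by rewrite size_window; split=> //; apply/left_specialP.
have [j jE] := lu.1; rewrite su in jE; rewrite -jE in lu *.
by apply/agree_windowP; apply: left_special_unique => //; apply/left_specialP.
Qed.

End Unique.

Lemma aperiodicP (A : Type) (x : int -> A) :
  aperiodic x <-> aperiodic_right x /\ aperiodic_left x.
Proof.
split=> [H|[Hr Hl]]; last first.
  move=> p N p1; have [n [h1 h2]] := Hl p N p1; have [n' [h3 h4]] := Hr p N p1.
  by exists n, n'.
by split=> p N p1; have [n [n' [h1 h2 h3 h4]]] := H p N p1; [exists n'|exists n].
Qed.

Section Shift.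
Variables (A : finType) (x : int -> A) (m : int).

Lemma agree_shift i j n :
  agree (shiftZ m x) i j n <-> agree x (i + m) (j + m) n.
Proof.
by split=> H t tP; have := H t tP; rewrite /shiftZ !(addrAC _ m).
Qed.

Lemma covers_shift a b : covers (shiftZ m x) a b -> covers x (a + m) (b + m).
Proof.
move=> cov n n1 i; have [j [jP /agree_shift ij]] := cov n n1 (i - m).
by exists (j + m); rewrite subrK in ij; split=> //; lia.
Qed.

Lemma right_special_shift i n :
  right_special_at x (i + m) n -> right_special_at (shiftZ m x) i n.
Proof.
move=> [j [ij ne]]; exists (j - m); split.
  by apply/agree_shift; rewrite subrK.
by rewrite /shiftZ (addrAC i) (addrAC (j - m)) subrK.
Qed.

Lemma left_special_shift i n :
  left_special_at x (i + m) n -> left_special_at (shiftZ m x) i n.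
Proof.
move=> [j [ij ne]]; exists (j - m); split.
  by apply/agree_shift; rewrite subrK.
by rewrite /shiftZ (addrAC i) (addrAC (j - m)) subrK.
Qed.

Lemma aperiodic_shift : aperiodic (shiftZ m x) <-> aperiodic x.
Proof.
split=> H p N p1.
  have [n [n' [h1 h2 h3 h4]]] := H p (N - m) p1; exists (n + m), (n' + m).
  by move: h3 h4; rewrite /shiftZ (addrAC n) (addrAC n'); split=> //; lia.
have [n [n' [h1 h2 h3 h4]]] := H p (N + m) p1; exists (n - m), (n' - m).
rewrite /shiftZ (addrAC (n - m)) (addrAC (n' - m)) !subrK.
by split=> //; lia.
Qed.

End Shift.

Lemma complexity_shift (A : finType) (x : int -> A) m n :
  complexity (shiftZ m x) n = complexity x n.
Proof.
have le y m' : (complexity (A := A) (shiftZ m' y) n <= complexity y n)%N.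
  have [L [<- _ _ cL]] := complexity_reps y n.
  rewrite -(size_map (fun i : int => i - m')); apply: complexity_le => i.
  have [j jL ij] := cL (i + m'); exists (j - m'); first exact: map_f.
  by apply/agree_shift; rewrite subrK.
apply/eqP; rewrite eqn_leq le /=.
have {1}-> : x = shiftZ (- m) (shiftZ m x); last exact: le.
by apply/funext => i; rewrite /shiftZ subrK.
Qed.

(** The definition gives the special words at [0] and at [size u] for large [n];
    shorter ones are suffixes and prefixes of these. *)
Lemma characteristic_interval (A : finType) (y : int -> A) : characteristic y ->
  exists (a b : int) (n1 : nat), covers y a b /\
    forall n, (n1 <= n)%N -> (complexity y n)%:Z = n%:Z + (b - a).
Proof.
move=> [[/aperiodicP[apr apl] [n0 [k [k1 cE]]]] [u uP]].
have np := aperiodic_not_periodic apr.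
have cS n : (n0 <= n)%N -> (complexity y n.+1 <= (complexity y n).+1)%N.
  by move=> le; rewrite !cE; lia.
have rl n : (n0 <= n)%N -> right_special_at y (- n%:Z) n /\
    left_special_at y (size u)%:Z n.
  move=> le; have [i ri] := right_special_exists n np.
  have npm := aperiodic_not_periodic (aperiodic_right_mirror apl).
  have [j rj] := right_special_exists n npm.
  have lj := left_special_mirror erefl rj; rewrite mirrorK in lj.
  have := uP n _ _ (is_r_window (cS n le) ri) (is_ell_window (cS n le) lj).
  rewrite !window_cat -catA => /eqP.
  rewrite eqseq_cat ?size_window // => /andP[/eqP er].
  rewrite eqseq_cat ?size_window // => /andP[_ /eqP el].
  split; first by apply/right_specialP; rewrite er; apply/right_specialP.
  apply/left_specialP; move: el; rewrite PoszD addrA addNr add0r => ->.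
  exact/left_specialP.
have rinf n : right_special_at y (0 - n%:Z) n.
  by apply: right_special_suffix (rl (maxn n n0) ltac:(lia)).1 _ _; lia.
have linf n : left_special_at y (size u)%:Z n.
  by apply: left_special_prefix (rl (maxn n n0) ltac:(lia)).2 _; lia.
exists 0, ((size u)%:Z - 1), n0; split.
  exact: (characteristic_covers apr apl cE rinf linf).
move=> n le; rewrite (characteristic_complexity apr apl cE rinf linf) //.
Qed.

Lemma shifted_characteristic_interval (A : finType) (x : int -> A) :
  (exists m, characteristic (shiftZ m x)) ->
  exists (a b : int) (n1 : nat), covers x a b /\
    forall n, (n1 <= n)%N -> (complexity x n)%:Z = n%:Z + (b - a).
Proof.
move=> [m /characteristic_interval[a [b [n1 [cov cE]]]]].
exists (a + m), (b + m), n1; split; first exact: covers_shift.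
by move=> n /cE; rewrite complexity_shift => ->; lia.
Qed.

(** The word between the two special positions is the word [u] of the
    definition; that its length is not negative comes from the attractor that
    these positions delimit. *)
Lemma covers_characteristic (A : finType) (x : int -> A) (a b : int) :
  covers x a b -> aperiodic_right x -> aperiodic_left x ->
  exists m, characteristic (shiftZ m x).
Proof.
move=> cov apr apl; have np := aperiodic_not_periodic apr.
have [n0 [k [k1 cE]]] := complexity_eventually_affine cov np.
have cS n : (n0 <= n)%N -> (complexity x n.+1 <= (complexity x n).+1)%N.
  by move=> le; rewrite !cE; lia.
have [m rinf] := right_special_position cov apr cS.
have [|M lM] := right_special_position (n0 := n0) (covers_mirror cov)
    (aperiodic_right_mirror apl).
  by move=> n le; rewrite !complexity_mirror; apply: cS.
have linf n : left_special_at x (1 - M) n.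
  rewrite -(mirrorK x); apply: (left_special_mirror _ (lM n)); lia.
have mM := covers_le (characteristic_covers apr apl cE rinf linf).
exists m; split.
  split; first by apply/aperiodic_shift/aperiodicP.
  by exists n0, k; split=> // n; rewrite complexity_shift; apply: cE.
exists (window (shiftZ m x) 0 `|(1 - M - m)%R|%N) => n r l hr hl.
rewrite size_window !window_cat -catA.
rewrite (is_r_eq (i := - n%:Z) hr); last first.
  by apply: right_special_shift; rewrite addrC.
rewrite (is_ell_eq (i := `|(1 - M - m)%R|%N%:Z) hl); last first.
  by apply: left_special_shift; have -> : `|(1 - M - m)%R|%N%:Z + m = 1 - M by lia.
by rewrite PoszD addrA addNr add0r.
Qed.

Theorem theorem43 (A : finType) (x : int -> A) :
  let case1 := purely_periodic x in
  let case2 := eventually_periodic x /\ ~ purely_periodic x in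
  let case3 := exists m : int, characteristic (shiftZ m x) in
  [/\ (exists G : set int, finite_set G /\ string_attractor x G) <->
        [\/ case1, case2 | case3],
      [/\ ~ (case1 /\ case2), ~ (case1 /\ case3) & ~ (case2 /\ case3)],
      forall p : nat, minimal_period x p ->
        exists n0 : nat, forall n : nat, (n0 <= n)%N ->
          complexity x n = p /\ (word_span x < p%:Z%:E)%E,
      case2 -> exists n0 : nat, forall n : nat, (n0 <= n)%N ->
        (complexity x n)%:Z%:E = (n%:Z%:E + word_span x)%E &
      case3 -> exists n0 : nat, forall n : nat, (n0 <= n)%N ->
        (complexity x n)%:Z%:E = (n%:Z%:E + word_span x)%E].
Proof.
move=> case1 case2 case3.
have ap3 : case3 -> aperiodic_right x /\ aperiodic_left x.
  by move=> [m [[/aperiodic_shift/aperiodicP]]].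
split.
- split=> [/finite_attractorP[a [b cov]]|].
    have [h1|np] := EM case1; first by constructor 1.
    have [ev|nev] := EM (eventually_periodic x); first by constructor 2.
    suff [apr apl] : aperiodic_right x /\ aperiodic_left x.
      by constructor 3; apply: covers_characteristic cov apr apl.
    have lr := covers_aperiodic cov.
    have rl : aperiodic_right x -> aperiodic_left x.
      move=> apr; rewrite -(mirrorK x); apply: aperiodic_left_mirror.
      by apply: covers_aperiodic (covers_mirror cov) (aperiodic_left_mirror apr).
    suff : aperiodic_right x \/ aperiodic_left x.
      by case=> ap; split=> //; [exact: rl|exact: lr].
    apply: contrapT => /not_orP[napr napl]; apply: nev.
    move: napr => /existsNP[p /existsNP[Np /not_implyP[p1 hp]]].
    move: napl => /existsNP[q /existsNP[Nq /not_implyP[q1 hq]]].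
    exists p, q, Np, (Nq + q%:Z); split=> // t tP; apply: contrapT => ne.
      by apply: hp; exists t.
    apply: hq; exists (t - q%:Z); split; first by lia.
    by rewrite subrK => e; apply: ne.
  case=> [[p per]|[ev np]|h3]; apply/finite_attractorP.
  + by exists 0, (p%:Z - 1); apply: periodic_covers.
  + have [a [b [_ [cov _]]]] := eventually_periodic_interval ev np.
    by exists a, b.
  + have [a [b [_ [cov _]]]] := shifted_characteristic_interval h3.
    by exists a, b.
- split; first by case=> h1 [].
    by case=> h1 /ap3[apr _]; apply: (aperiodic_not_periodic apr).
  case=> [[[p [q [Np [Nq [p1 q1 hp hq]]]]] _] /ap3[apr _]].
  by have [n [Nn []]] := apr p Np p1; apply: hp.
- move=> p minp; exists p => n pn; split; first exact: minimal_period_complexity.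
  have [k kp ->] := word_span_le (periodic_covers minp.1).
  by rewrite lte_fin; lia.
- move=> [ev np]; have [a [b [n1 [cov cE]]]] := eventually_periodic_interval ev np.
  by exists n1; apply: word_span_complexity cov cE.
- move=> /shifted_characteristic_interval[a [b [n1 [cov cE]]]].
  by exists n1; apply: word_span_complexity cov cE.
Qed.
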